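(* Let $G$ be a $4$-regular plane graph of mincut $4$ with $n$ vertices, root-vertex $v^*$, and an even regular decomposition $(T_1^*,\dots,T_4^* )$. Let $\widetilde G$ be obtained from $G$ by replacing each pair of parallel edges bounding a face of degree $2$ by a single edge. Placing each non-root vertex $v$ at the point $\mathrm{p}(v)=(x(v),y(v))$ of the grid $\{0,\dots,n-2\}^2$ and drawing each edge as a straight segment yields a planar straight-line drawing of $\widetilde G\setminus v^*$. Moreover, the points $\mathrm{p}(v_1^* ),\mathrm{p}(v_2^* ),\mathrm{p}(v_3^* ),\mathrm{p}(v_4^* )$ lie respectively on the bottom, left, top and right boundaries of this grid.
   Context: Graphs are finite, loopless, possibly with multiple edges; a plane graph is a connected planar graph with a fixed crossing-free drawing. Mincut = minimum number of edges whose deletion disconnects the graph. Colors are modulo $4$. Root-edges $e_1^*,\dots,e_4^*$ are the edges incident to $v^*$ in counterclockwise order, and $v_i^*$ is the other endpoint of $e_i^*$. The faces incident to $v^*$ are root-faces; the other $n-2$ faces are non-root faces. A regular decomposition is a covering of the edges by spanning trees $T_1^*,\dots,T_4^*$, each oriented toward $v^*$, such that: (i) each edge not incident to $v^*$ is in exactly two trees with opposite orientations; (ii) $e_i^*$ is only in $T_i^*$; (iii) around each non-root vertex $v$ the edges leading $v$ to its parent in $T_1^*,\dots,T_4^*$ appear in clockwise order. It is even if each edge not incident to $v^*$ lies in two trees of indices of different parities. $P_i(v)$ is the directed path from $v$ to $v^*$ in $T_i^*$; $P_i(v)$ and $P_{i+2}(v)$ meet only at $v,v^*$, so $P_i(v)\cup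 P_{i+2}(v)$ is a simple cycle; $R_{i,i+2}(v)$ is the region of the plane bounded by this cycle that contains the root-edge $e_{i+1}^*$. Then $x(v)$ is the number of non-root faces in $R_{1,3}(v)$ and $y(v)$ the number of non-root faces in $R_{4,2}(v)$. *)

(* Defs.v *)
From HB Require Import structures.
From mathcomp Require Import all_boot all_order all_algebra all_fingroup.
Set Implicit Arguments.
Unset Strict Implicit.
Unset Printing Implicit Defensive.
Import Order.TTheory GRing.Theory Num.Theory.

(* Each edge e carries the two darts (e, true) and (e, false), one for each
   direction of traversal. *)
Definition dart (E : finType) : finType := (E * bool)%type.

Definition rev_dart (E : finType) (d : dart E) : dart E := (d.1, ~~ d.2).

Lemma rev_dart_inj (E : finType) : injective (@rev_dart E).
Proof.
by apply: (can_inj (g := @rev_dart E)) => -[e b]; rewrite /rev_dart /= negbK.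
Qed.

(* ccw sends a dart to the next one counterclockwise around its origin.  A
   walker following d with the face on its left leaves the end of d by the
   dart that comes next clockwise after rev_dart d; so the orbit of d under
   face_perm is the contour of the face on the left of d. *)
Definition face_perm (E : finType) (ccw : {perm dart E}) : {perm dart E} :=
  (perm (@rev_dart_inj E) * ccw^-1)%g.

Definition edge_adj (V E : finType) (source : dart E -> V) (T : {set E}) : rel V :=
  [rel u w | [exists d : dart E,
     [&& d.1 \in T, source d == u & source (rev_dart d) == w]]].

(* A connected loopless plane multigraph, up to orientation-preserving
   homeomorphism of the sphere, is a connected rotation system that satisfies
   Euler's formula.  (The graph with one vertex and no edge has no dart, and is
   left out.) *)
Record plane_graph := PlaneGraph {
  vertex : finType;
  edge : finType;
  source : dart edge -> vertex;
  ccw : {perm dart edge};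
  source_ccw : forall d d', (source d == source d') = (d' \in porbit ccw d);
  loopless : forall d, source d != source (rev_dart d);
  plane_connected : forall u w, connect (edge_adj source [set: edge]) u w;
  euler : (#|vertex| + #|porbits (face_perm ccw)| = #|edge| + 2)%N
}.

Section PlaneGraph.
Variable G : plane_graph.

Local Notation V := (vertex G).
Local Notation E := (edge G).
Local Notation D := (dart (edge G)).

Definition target (d : D) : V := source (rev_dart d).

Definition regular_of_degree (k : nat) : Prop :=
  forall v : V, #|[set d : D | source d == v]| = k.

Definition disconnecting (S : {set E}) : Prop :=
  exists u w : V, ~~ connect (edge_adj (@source G) (~: S)) u w.

Definition mincut (k : nat) : Prop :=
  (exists2 S : {set E}, disconnecting S & #|S| = k) /\
  (forall S : {set E}, disconnecting S -> k <= #|S|).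

Definition face_of (d : D) : {set D} := porbit (face_perm (ccw G)) d.

Definition faces : {set {set D}} := porbits (face_perm (ccw G)).

Definition edges_at (v : V) : {set E} :=
  [set d.1 | d in [set d : D | source d == v]].

(* Two parallel edges on a cycle are allowed: the vertices, and separately the
   edges, of a cycle are pairwise distinct, so a single edge traversed back and
   forth is not a cycle. *)
Definition is_cycle (c : seq D) : Prop :=
  [/\ c != [::],
      path.cycle [rel d d' | target d == source d'] c,
      uniq [seq source d | d <- c]
    & uniq [seq d.1 | d <- c]].

Definition spanning_tree (T : {set E}) : Prop :=
  (forall u w : V, connect (edge_adj (@source G) T) u w) /\
  ~ (exists2 c : seq D, is_cycle c & {subset [seq d.1 | d <- c] <= T}).

(* An oriented tree is the set A of its arcs: a dart d of A is the edge d.1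
   oriented from source d to target d. *)
Definition tree_edges (A : {set D}) : {set E} := [set d.1 | d in A].

Definition arc_rel (A : {set D}) : rel V :=
  [rel u w | [exists d in A, (source d == u) && (target d == w)]].

Definition spanning_tree_toward (vs : V) (A : {set D}) : Prop :=
  [/\ spanning_tree (tree_edges A),
      (forall d, d \in A -> rev_dart d \notin A)
    & (forall v : V, connect (arc_rel A) v vs)].

(* Colors are modulo 4, so that color 4 is (0 : 'Z_4). *)
Definition root_edges (vs : V) (r : 'Z_4 -> D) : Prop :=
  forall i, source (r i) = vs /\ r (i + 1)%R = ccw G (r i).

(* This is the definition for 4-regular graphs.  By the second and third
   clauses the arcs leaving a non-root vertex in the four trees are pairwise
   distinct, hence they are all the darts at this vertex; their clockwise order
   in the last clause therefore means that each follows immediately the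
   previous one. *)
Definition regular_decomposition (vs : V) (r : 'Z_4 -> D)
    (A : 'Z_4 -> {set D}) : Prop :=
  [/\ (forall i, spanning_tree_toward vs (A i)),
      (forall e : E, e \notin edges_at vs ->
         exists i j : 'Z_4,
           [/\ i != j, (e, true) \in A i, (e, false) \in A j
             & forall k, e \in tree_edges (A k) -> k = i \/ k = j]),
      (forall i j : 'Z_4, ((r i).1 \in tree_edges (A j)) = (j == i))
    & (forall (i : 'Z_4) (d : D), d \in A i -> source d != vs ->
         (ccw G)^-1%g d \in A (i + 1)%R)].

Definition even_decomposition (vs : V) (A : 'Z_4 -> {set D}) : Prop :=
  forall (e : E) (i j : 'Z_4), e \notin edges_at vs -> i != j ->
    e \in tree_edges (A i) -> e \in tree_edges (A j) -> odd i != odd j.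

Section Coordinates.
Variables (vs : V) (r : 'Z_4 -> D) (A : 'Z_4 -> {set D}).

(* The edges of the directed path P_i(v) from v to vs in the i-th tree: since
   this tree is oriented toward vs, a vertex other than vs has exactly one
   outgoing arc, and vs has none. *)
Definition tree_path (i : 'Z_4) (v : V) : {set E} :=
  tree_edges [set d in A i | connect (arc_rel (A i)) v (source d)].

Definition dual_adj (C : {set E}) : rel {set D} :=
  [rel F F' | [exists d : D,
     [&& d.1 \notin C, F == face_of d & F' == face_of (rev_dart d)]]].

(* The faces of R_{i,i+2}(v).  The components of the complement of the cycle C
   are obtained by gluing faces along edges outside of C; the root-edge of
   index i+1 is not in C, so both its sides are in its component. *)
Definition region (i : 'Z_4) (v : V) : {set {set D}} :=
  let C := tree_path i v :|: tree_path (i + 2%:R)%R v in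
  [set F in faces | connect (dual_adj C) (face_of (r (i + 1)%R)) F].

Definition nonroot_faces : {set {set D}} :=
  [set F in faces | [forall d in F, source d != vs]].

Definition xcoord (v : V) : nat := #|region 1%R v :&: nonroot_faces|.
Definition ycoord (v : V) : nat := #|region 4%:R%R v :&: nonroot_faces|.

End Coordinates.

Definition bound_digon : rel E :=
  [rel e f | [exists d : D, [exists d' in face_of d,
     [&& #|face_of d| == 2, d.1 == e & d'.1 == f]]]].

(* The graph obtained by replacing each pair of parallel edges bounding a face
   of degree 2 by a single edge: one edge is kept in each class of the
   equivalence relation generated by these pairs. *)
Definition merged_edges : {set E} := [set e | roots bound_digon e].

End PlaneGraph.

Section Drawing.
Local Open Scope ring_scope.

Definition on_segment (R : realFieldType) (a b q : R * R) : Prop :=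
  exists2 t : R, 0 <= t <= 1 &
    q = ((1 - t) * a.1 + t * b.1, (1 - t) * a.2 + t * b.2).

Definition endpoint (G : plane_graph) (w : vertex G) (e : edge G) : bool :=
  (w == source (e, true)) || (w == source (e, false)).

(* What is drawn is the subgraph of G with vertex set W and edge set F. *)
Definition planar_straight_line_drawing (R : realFieldType) (G : plane_graph)
    (W : {set vertex G}) (F : {set edge G}) (p : vertex G -> R * R) : Prop :=
  let seg e := on_segment (p (source (e, true))) (p (source (e, false))) in
  [/\ {in W &, injective p},
      (forall e w, e \in F -> w \in W -> seg e (p w) -> endpoint w e)
    & (forall e f q, e \in F -> f \in F -> e != f -> seg e q -> seg f q ->
         exists w, [/\ endpoint w e, endpoint w f & q = p w])].

End Drawing.

(* Main.v *)
(* Every circulation on the darts is the jump of a potential on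
   the faces (this is where Euler's formula enters), so the region R_(i,i+2)(v)
   can be replaced by the potential of the flow P_(i+2)(v) - P_i(v), which turns
   out to be its indicator function.  Along an arc of color i+1 the potentials at
   the two ends differ by a nonzero function with values in {0, 1}: the difference
   has its jumps on one tree and one extra edge, hence takes two values.
   Therefore both coordinates are strictly monotone along every edge.

   Going around a non-root face, the color of the darts is constant except for
   two turns, at which it changes by 2 (a count based on Euler's formula shows that
   there are exactly two).  So the face consists of two monotone chains joined by
   two edges, and comparing potentials shows that one of the chains lies strictly
   to the upper left (or lower left) of the other.  Consequently, where a
   horizontal line crosses the face, it enters through an edge that lies to the
   left of the edge through which it leaves.  Walking from face to face along the
   line orders all the edges that it crosses, and two of them can only meet at a
   common upper end, unless they bound a face of degree 2. *)
Require Import Defs.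
From mathcomp Require Import all_boot all_order all_algebra all_fingroup.
From mathcomp Require Import zify ring lra.
Set Implicit Arguments.
Unset Strict Implicit.
Unset Printing Implicit Defensive.
Import Order.TTheory GRing.Theory Num.Theory.

(** * Potentials on faces *)

(** No Jordan curve theorem is used. A circulation supported on a tree, or on a cycle [P_i(v)],
    [P_(i+2)(v)] with one arc removed, vanishes by conservation; this gives both the two-valued
    differences and the identification of potentials with regions. That a potential is 0 or 1 comes
    from integrality: it is a natural number, and so is its complement to 1.

    Evenness makes the dart entering a parent adjacent in the rotation to the outgoing arc of the
    same color, so that values on faces can be transported along tree paths.

    Summed around a non-root face, the arcs telescope to the cycle flows at its two turns. Hence the
    regions at these turns differ by that face alone, and the two chains are at a vertical distance
    of exactly one. The only delicate comparison, between two edges that both join the chains,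
    therefore takes place in a strip of height one.

    The sweep is a linear order because a non-root face has at most one descending edge per strip,
    and because all walks to the right end on a single descending path, formed by the two root-faces
    at the fourth root-edge. *)

Section ConstantRow.
Local Open Scope ring_scope.

Lemma constant_sub_const_mx (F : fieldType) n (v : 'rV[F]_n) :
  (forall i j, v 0 i = v 0 j) -> (v <= (const_mx 1 : 'rV[F]_n))%MS.
Proof.
case: n v => [|n] v vE; first by rewrite thinmx0 sub0mx.
suff -> : v = v 0 0 *: const_mx 1 by rewrite scalemx_sub.
by apply/rowP => j; rewrite !mxE mulr1; apply: vE.
Qed.

End ConstantRow.

Section Potentials.
Local Open Scope ring_scope.
Variable G : plane_graph.
Local Notation V := (vertex G).
Local Notation E := (edge G).
Local Notation D := (dart (edge G)).
Implicit Types (d : D) (h phi : D -> rat) (v : V).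

Lemma rev_dartK : involutive (@rev_dart E).
Proof. by case=> e b; rewrite /rev_dart /= negbK. Qed.

Lemma source_rev_neq d : source (rev_dart d) != source d.
Proof. by rewrite eq_sym loopless. Qed.

Lemma source_ccw_eq d : source (ccw G d) = source d.
Proof. by apply/esym/eqP; rewrite source_ccw -[X in X \in _]/((ccw G) d) -{1}[ccw G]expg1
  mem_porbit. Qed.

Lemma source_ccwV d : source ((ccw G)^-1%g d) = source d.
Proof. by rewrite -{2}[d](permKV (ccw G)) source_ccw_eq. Qed.

Lemma face_permE d : face_perm (ccw G) d = (ccw G)^-1%g (rev_dart d).
Proof. by rewrite permM permE. Qed.

Lemma source_face_perm d : source (face_perm (ccw G) d) = target d.
Proof. by rewrite face_permE source_ccwV. Qed.

(* Such an [h] is a function on faces: [h d] is its value on the face on the left of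
   [d], and [jump h d] is the value on the left of [d] minus the value on its right. *)
Definition facefun h := forall d, h (face_perm (ccw G) d) = h d.

Definition jump h d := h d - h (rev_dart d).

Definition circulation phi :=
  (forall d, phi (rev_dart d) = - phi d) /\
  (forall v, \sum_(d | source d == v) phi d = 0).

Lemma facefun_ccwV h d : facefun h -> h ((ccw G)^-1%g d) = h (rev_dart d).
Proof. by move=> hh; rewrite -(hh (rev_dart d)) face_permE rev_dartK. Qed.

Lemma facefun_ccw h d : facefun h -> h (rev_dart (ccw G d)) = h d.
Proof. by move=> hh; rewrite -facefun_ccwV // permK. Qed.

Lemma jump_rev h d : jump h (rev_dart d) = - jump h d.
Proof. by rewrite /jump rev_dartK opprB. Qed.

Lemma jump_circ h : facefun h -> circulation (jump h).
Proof.
move=> hh; split=> [d|v]; first exact: jump_rev.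
rewrite /jump sumrB; apply/eqP; rewrite subr_eq0; apply/eqP.
rewrite [RHS](eq_bigr (fun d => h ((ccw G)^-1%g d))); last first.
  by move=> d _; rewrite facefun_ccwV.
rewrite [LHS](reindex_inj (@perm_inj _ (ccw G)^-1%g)) /=.
by apply: eq_bigl => d; rewrite source_ccwV.
Qed.

(** The rotation reaches every dart at a vertex and reversal moves to the other end of the edge, so
    connectivity of the graph becomes an induction principle on darts. *)
Lemma dart_connected (P : D -> Prop) d0 :
  P d0 -> (forall d, P d -> P (rev_dart d)) -> (forall d, P d -> P (ccw G d)) ->
  forall d, P d.
Proof.
move=> P0 Prev Pccw.
have Psrc d d' : source d = source d' -> P d -> P d'.
  move/eqP; rewrite source_ccw => /porbitP [k ->] Pd.
  by elim: k => [|k IH]; rewrite ?expg0 ?perm1 // expgSr permM; apply: Pccw.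
move=> d; have /connectP [p] := plane_connected (source d0) (source d).
elim: p d0 P0 => [|u p IH] d0 P0 /=; first by move=> _ sd; apply: Psrc P0.
case/andP=> /existsP [e /and3P [_ /eqP s1 /eqP s2]] pp ld.
apply: (IH (rev_dart e)); rewrite ?s2 //.
by apply: Prev; apply: Psrc P0; rewrite s1.
Qed.

Lemma facefun_const h : facefun h -> (forall d, jump h d = 0) ->
  forall d d', h d = h d'.
Proof.
move=> hh j0 d d'; have jE e : h (rev_dart e) = h e.
  by move/eqP: (j0 e); rewrite subr_eq0 => /eqP.
apply: (dart_connected (P := fun e => h e = h d')) => // e <-.
  by rewrite jE.
by rewrite -(facefun_ccw e hh) jE.
Qed.

Lemma facefun_face h d d' : facefun h -> d' \in face_of d -> h d' = h d.
Proof.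
move=> hh /porbitP [k ->]; elim: k => [|k IH]; first by rewrite expg0 perm1.
by rewrite expgSr permM hh.
Qed.

Lemma mem_face_perm d d' : (face_perm (ccw G) d' \in face_of d) = (d' \in face_of d).
Proof.
by rewrite /face_of -!eq_porbit_mem -[face_perm _ d']/((face_perm (ccw G)) d') -{2}[face_perm
  _]expg1 porbit_perm.
Qed.

Lemma face_of_perm d : face_of (face_perm (ccw G) d) = face_of d.
Proof. by apply/eqP; rewrite eq_porbit_mem mem_face_perm porbit_id. Qed.


Lemma sum_face_ind (c : {set D} -> rat) d :
  \sum_(F in faces G) c F * (d \in F)%:R = c (face_of d).
Proof.
have Fd : face_of d \in faces G by apply: imset_f.
rewrite (bigD1 (face_of d)) //= porbit_id mulr1 big1 ?addr0 // => F.
case/andP=> /imsetP [d' _ ->] ne.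
case: (boolP (d \in _)) => [dd|_]; last by rewrite mulr0.
by case/negP: ne; rewrite eq_porbit_mem porbit_sym.
Qed.

Lemma sum_edges_darts (F : D -> rat) : 
  \sum_d F d = \sum_(e : E) (F (e, true) + F (e, false)).
Proof.
transitivity (\sum_(e : E) \sum_(b : bool) F (e, b)).
  by rewrite pair_big; apply: eq_bigr => -[].
by apply: eq_bigr => e _; rewrite big_bool.
Qed.

Lemma face_ind_facefun (F : {set D}) : F \in faces G -> facefun (fun d => (d \in F)%:R).
Proof. by move=> /imsetP [d0 _ ->] d; rewrite mem_face_perm. Qed.

(* The face boundaries span the circulations: both spaces have dimension
   [#|faces G| - 1] by Euler's formula and connectivity. *)
Lemma circulation_potential phi : circulation phi ->
  exists2 h, facefun h & forall d, jump h d = phi d.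
Proof.
case=> anti div0.
pose ev := enum_val : 'I_#|E| -> E; pose vv := enum_val : 'I_#|V| -> V.
pose fv := enum_val : 'I_#|faces G| -> {set D}.
(* [B] is the incidence matrix, whose left kernel consists of the circulations, and the rows of [C]
   are the face boundaries. An edge is represented by its dart with flag [true]. *)
pose B : 'M[rat]_(#|E|, #|V|) := \matrix_(i, j)
  ((source (ev i, true) == vv j)%:R - (source (ev i, false) == vv j)%:R).
pose C : 'M[rat]_(#|faces G|, #|E|) := \matrix_(i, j)
  (((ev j, true) \in fv i)%:R - ((ev j, false) \in fv i)%:R).
have mulB (psi : D -> rat) : circulation psi -> (\row_i psi (ev i, true)) *m B = 0.
  case=> anti' div'; apply/rowP => j; rewrite !mxE -[RHS](div' (vv j)).
  rewrite [RHS]big_mkcond [RHS]sum_edges_darts [RHS](reindex ev) /=; last first.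
    by apply: onW_bij; apply: enum_val_bij.
  apply: eq_bigr => i _; rewrite !mxE -[(ev i, false)]/(rev_dart (ev i, true)) anti'.
  by do 2!case: (_ == _); rewrite ?(mulr1, mulr0, subr0, sub0r, mulrN, subrr, addr0, add0r).
have CB : (C <= kermx B)%MS.
  apply/row_subP => i; apply/sub_kermxP.
  have FF : fv i \in faces G by apply: enum_valP.
  rewrite -(mulB _ (jump_circ (face_ind_facefun FF))); congr (_ *m _).
  by apply/rowP => j; rewrite !mxE.
(* The kernel of [B^T] consists of the vertex functions that agree at the two ends of each edge; by
   connectivity they are constant. *)
have rkB : (#|V| - \rank B <= 1)%N.
  rewrite -mxrank_tr -mxrank_ker.
  apply: leq_trans (rank_leq_row (const_mx 1 : 'rV[rat]_#|V|)).
  have cst1 : (kermx B^T <= (const_mx 1 : 'rV[rat]_#|V|))%MS.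
    apply/rV_subP => v /sub_kermxP vB.
    have step u w : v 0 (enum_rank u) = v 0 (enum_rank w).
      have /connectP [p] := plane_connected u w.
      elim: p u => [|x p IH] u /=; first by move=> _ ->.
      case/andP=> /existsP [[e b] /and3P [_ /eqP <- /eqP <-]] pp lp.
      rewrite -(IH _ pp lp).
      have /rowP /(_ (enum_rank e)) := vB; rewrite !mxE.
      rewrite (eq_bigr (fun j => v 0 j * (vv j == source (e, true))%:R
                       - v 0 j * (vv j == source (e, false))%:R)); last first.
        by move=> j _; rewrite !mxE /ev enum_rankK mulrBr ![vv j == _]eq_sym.
      rewrite sumrB /=.
      have sumE z : \sum_j v 0 j * (vv j == z)%:R = v 0 (enum_rank z).
        rewrite (bigD1 (enum_rank z)) //= /vv enum_rankK eqxx mulr1 big1 ?addr0 //.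
        move=> j nj; case: eqP => [jz|]; last by rewrite mulr0.
        by case/eqP: nj; rewrite -jz enum_valK.
      rewrite !sumE => /eqP; rewrite subr_eq0 => /eqP vE.
      by rewrite /rev_dart; case: (b) => /=.
    apply: constant_sub_const_mx => i j.
    by rewrite -[i]enum_valK -[j]enum_valK; apply: step.
  exact: mxrankS.
(* A vanishing combination of face boundaries is a face function without jumps, hence constant. *)
have rkC : (#|faces G| - \rank C <= 1)%N.
  rewrite -mxrank_ker.
  apply: leq_trans (rank_leq_row (const_mx 1 : 'rV[rat]_#|faces G|)).
  apply: mxrankS; apply/rV_subP => v /sub_kermxP vC.
  pose c (F : {set D}) : rat := \sum_(j | fv j == F) v 0 j.
  have cE j : c (fv j) = v 0 j.
    by rewrite /c (eq_bigl (xpred1 j)) ?big_pred1_eq // => k; rewrite (inj_eq enum_val_inj).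
  have ffc : facefun (fun d => c (face_of d)) by move=> d; rewrite face_of_perm.
  have jc d : jump (fun d => c (face_of d)) d = 0.
    wlog ->: d / d = (d.1, true).
      case: d => e [] IH; first exact: IH.
      by rewrite -[(e, false)]/(rev_dart (e, true)) jump_rev IH ?oppr0.
    rewrite /jump -!sum_face_ind -sumrB.
    have /rowP /(_ (enum_rank d.1)) := vC; rewrite !mxE => vCE.
    rewrite -[RHS]vCE big_enum_val /=; apply: eq_bigr => j _.
    by rewrite !mxE cE /ev enum_rankK mulrBr.
  apply: constant_sub_const_mx => i j; rewrite -!cE /fv.
  have /imsetP [d _ ->] := enum_valP i.
  have /imsetP [d' _ ->] := enum_valP j.
  exact: (facefun_const ffc jc).
(* Euler's formula turns the two rank bounds into equality of dimensions. The coefficients [u] that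
   then express [phi] by face boundaries are the values of its potential. *)
have : (kermx B <= C)%MS.
  rewrite -(mxrank_leqif_sup CB) mxrank_ker eqn_leq -{1}(mxrank_ker B) (mxrankS CB) /=.
  have arith (v f e rb rc : nat) : (v + f = e + 2 -> v - rb <= 1 -> f - rc <= 1 ->
    e - rb <= rc)%N by lia.
  exact: arith (euler G) rkB rkC.
move/(submx_trans (introT sub_kermxP (mulB _ (conj anti div0)))) => /submxP [u uE].
pose c (F : {set D}) : rat := \sum_(j | fv j == F) u 0 j.
have cE j : c (fv j) = u 0 j.
  by rewrite /c (eq_bigl (xpred1 j)) ?big_pred1_eq // => k; rewrite (inj_eq enum_val_inj).
exists (fun d => c (face_of d)) => [d|]; first by rewrite face_of_perm.
have jE e : jump (fun d => c (face_of d)) (e, true) = phi (e, true).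
  rewrite /jump -!sum_face_ind -sumrB.
  have /rowP /(_ (enum_rank e)) := uE; rewrite !mxE /ev enum_rankK => ->.
  rewrite big_enum_val /=; apply: eq_bigr => j _.
  by rewrite !mxE cE /ev enum_rankK mulrBr.
case=> e [] //; rewrite -[(e, false)]/(rev_dart (e, true)) jump_rev anti.
by rewrite jE.
Qed.

End Potentials.

(** * Interpolation on segments *)

Section Interpolation.
Local Open Scope ring_scope.
Variable R : realFieldType.
Implicit Types (xa xb xc xe l m th s : R).

(** Here and below the left segment goes from abscissa [xb] at its bottom to [xa] at its top, the
    right one from [xc] to [xe], and [l], [m] are the fractions of height reached on them. Segments
    that lean toward each other are separated by their ordered tops, whatever the fractions are. *)
Lemma segments_meet_top xa xb xc xe l m : xb < xa -> xa <= xe -> xe < xc ->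
  l <= 1 -> m <= 1 ->
  xb + (xa - xb) * l <= xc + (xe - xc) * m /\
  (xb + (xa - xb) * l = xc + (xe - xc) * m -> l = 1 /\ xa = xe).
Proof.
move=> h1 h2 h3 l1 m1.
have p1 : 0 <= (xa - xb) * (1 - l) by apply: mulr_ge0; lra.
have p2 : 0 <= (xc - xe) * (1 - m) by apply: mulr_ge0; lra.
split=> [|e]; first by lra.
have z1 : (xa - xb) * (1 - l) = 0 by lra.
split; last by lra.
by move/eqP: z1; rewrite mulf_eq0 => /orP [] /eqP; lra.
Qed.

(** Segments that lean away from each other are separated by their ordered bottoms. *)
Lemma segments_apart xa xb xc xe l m : xa < xb -> xb <= xc -> xc < xe ->
  0 < l -> 0 < m -> xb + (xa - xb) * l < xc + (xe - xc) * m.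
Proof.
move=> h1 h2 h3 l0 m0.
have p1 : 0 < (xb - xa) * l by apply: mulr_gt0; lra.
have p2 : 0 < (xe - xc) * m by apply: mulr_gt0; lra.
lra.
Qed.

(** At the common fraction [th] the segments are ordered by convexity; the two sign hypotheses say
    that passing from [th] to [l] and [m] only widens the gap. *)
Lemma segments_thin xa xb xc xe l m th : xa <= xe -> xb <= xc ->
  0 < th -> th <= 1 -> (xa - xb) * (l - th) <= 0 -> 0 <= (xe - xc) * (m - th) ->
  xb + (xa - xb) * l <= xc + (xe - xc) * m /\
  (xb + (xa - xb) * l = xc + (xe - xc) * m -> xa = xe /\ (th = 1 \/ xb = xc)).
Proof.
move=> h1 h2 t0 t1 p1 p2.
have p3 : 0 <= (xe - xa) * th by apply: mulr_ge0; lra.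
have p4 : 0 <= (xc - xb) * (1 - th) by apply: mulr_ge0; lra.
split=> [|e]; first by lra.
have z1 : (xe - xa) * th = 0 by lra.
have z2 : (xc - xb) * (1 - th) = 0 by lra.
split; first by move/eqP: z1; rewrite mulf_eq0 => /orP [] /eqP; lra.
by move/eqP: z2; rewrite mulf_eq0 => /orP [] /eqP ?; [right|left]; lra.
Qed.

(** Abscissa at height [s] of the segment with top [(xa, ya)] and bottom [(xb, yb)]. *)
Definition interp (xa ya xb yb s : R) : R := xb + (xa - xb) * ((s - yb) / (ya - yb)).

Lemma interp_ratio (ya yb s : R) : yb < s -> s <= ya ->
  [/\ 0 < (s - yb) / (ya - yb), (s - yb) / (ya - yb) <= 1
    & (s - yb) / (ya - yb) * (ya - yb) = s - yb].
Proof.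
move=> h1 h2; have d0 : 0 < ya - yb by lra.
split; [by apply: divr_gt0; lra|by rewrite ler_pdivrMr // mul1r; lra|].
by rewrite divfK // gt_eqF.
Qed.

(** The heights will be integers, hence [yb + 1 <= t]: each segment spans the whole strip from
    [t - 1] to [t]. In the last two cases both lean the same way, one has its top at [t] and the
    other its bottom at [t - 1]; since their heights are at least 1, the fractions [l] and [m] lie
    on the two sides of the fraction [th] of the strip, as [segments_thin] requires. *)
Lemma interp_compare (xa ya xb yb xe ye xc yc t s : R) :
  yb + 1 <= t -> t <= ya -> yc + 1 <= t -> t <= ye -> t - 1 < s -> s <= t ->
  xa <= xe -> xb <= xc ->
  [\/ xb < xa /\ xe < xc, xa < xb /\ xc < xe,
      [/\ ya = t, yc + 1 = t, xa < xb & xe < xc]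
    | [/\ yb + 1 = t, ye = t, xb < xa & xc < xe]] ->
  interp xa ya xb yb s <= interp xe ye xc yc s /\
  (interp xa ya xb yb s = interp xe ye xc yc s ->
     xa = xe /\ (s = t /\ (ya = t \/ ye = t) \/ xb = xc)).
Proof.
move=> d1 d2 u1 u2 s0 s1 le1 le2 cases; rewrite /interp.
have yb_lt : yb < s by lra.
have yc_lt : yc < s by lra.
have [l0 l1 lE] := interp_ratio yb_lt (le_trans s1 d2).
have [m0 m1 mE] := interp_ratio yc_lt (le_trans s1 u2).
move: ((s - yb) / (ya - yb)) ((s - yc) / (ye - yc)) l0 l1 lE m0 m1 mE => l m l0 l1 lE m0 m1 mE.
pose th := s - (t - 1).
have th0 : 0 < th by rewrite /th; lra.
have th1 : th <= 1 by rewrite /th; lra.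
case: cases => [[a1 a2]|[a1 a2]|[yE1 yE2 a1 a2]|[yE1 yE2 a1 a2]].
- have [le eq] := segments_meet_top a1 le1 a2 l1 m1; split=> // /eq [lam xE].
  by split=> //; left; rewrite lam mul1r in lE; split; [|left]; lra.
- have lt := segments_apart a1 le2 a2 l0 m0; split; first exact: ltW.
  by move=> e; move: lt; rewrite e ltxx.
- have k1 : (1 - l) * (ya - yb) = 1 - th by rewrite /th; lra.
  have k2 : m * (ye - yc) = th by rewrite /th; lra.
  have q1 : 0 <= (1 - l) * (ya - yb - 1) by apply: mulr_ge0; lra.
  have q2 : 0 <= m * (ye - yc - 1) by apply: mulr_ge0; lra.
  have p1 : (xa - xb) * (l - th) <= 0 by apply: mulr_le0_ge0; lra.
  have p2 : 0 <= (xe - xc) * (m - th) by rewrite -mulrNN; apply: mulr_ge0; lra.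
  have [le eq] := segments_thin le1 le2 th0 th1 p1 p2.
  split=> // /eq [e1 e2]; split=> //; case: e2 => [e2|]; last by right.
  by left; rewrite /th in e2; split; [lra|left].
- have k1 : l * (ya - yb) = th by rewrite /th; lra.
  have k2 : (1 - m) * (ye - yc) = 1 - th by rewrite /th; lra.
  have q1 : 0 <= l * (ya - yb - 1) by apply: mulr_ge0; lra.
  have q2 : 0 <= (1 - m) * (ye - yc - 1) by apply: mulr_ge0; lra.
  have p1 : (xa - xb) * (l - th) <= 0 by apply: mulr_ge0_le0; lra.
  have p2 : 0 <= (xe - xc) * (m - th) by apply: mulr_ge0; lra.
  have [le eq] := segments_thin le1 le2 th0 th1 p1 p2.
  split=> // /eq [e1 e2]; split=> //; case: e2 => [e2|]; last by right.
  by left; rewrite /th in e2; split; [lra|right].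
Qed.

Lemma interp_top (xa ya xb yb : R) : yb < ya -> interp xa ya xb yb ya = xa.
Proof. by move=> h; rewrite /interp divff ?mulr1; [ring|rewrite subr_eq0 gt_eqF]. Qed.

Lemma interp_bottom (xa ya xb yb : R) : interp xa ya xb yb yb = xb.
Proof. by rewrite /interp subrr mul0r mulr0 addr0. Qed.

Lemma on_segment_interp (a b q : R * R) : b.2 < a.2 -> on_segment a b q ->
  [/\ b.2 <= q.2, q.2 <= a.2 & q.1 = interp a.1 a.2 b.1 b.2 q.2].
Proof.
move=> h [t /andP [t0 t1] ->] /=; rewrite /interp.
have p0 : 0 <= (a.2 - b.2) * t by apply: mulr_ge0; lra.
have p1 : 0 <= (a.2 - b.2) * (1 - t) by apply: mulr_ge0; lra.
split; try lra.
have -> : ((1 - t) * a.2 + t * b.2 - b.2) / (a.2 - b.2) = 1 - t.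
  have -> : (1 - t) * a.2 + t * b.2 - b.2 = (1 - t) * (a.2 - b.2) by ring.
  by rewrite mulfK // subr_eq0 gt_eqF.
ring.
Qed.

Lemma on_segment_sym (a b q : R * R) : on_segment a b q -> on_segment b a q.
Proof.
case=> t /andP [t0 t1] ->; exists (1 - t); first by apply/andP; split; lra.
by congr pair; ring.
Qed.

End Interpolation.

(** * Colors modulo 4 *)

Section Colors.
Local Open Scope ring_scope.

Lemma Z4_odd (i j : 'Z_4) : odd i != odd j -> j = i + 1 \/ j = i + 3.
Proof.
by case: i => [[|[|[|[|?]]]] ?] //; case: j => [[|[|[|[|?]]]] ?] //= _;
  (left; exact: val_inj) || (right; exact: val_inj).
Qed.

Lemma Z4_cases (i j : 'Z_4) : [\/ j = i, j = i + 1, j = i + 2 | j = i + 3].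
Proof.
by case: i => [[|[|[|[|?]]]] ?] //; case: j => [[|[|[|[|?]]]] ?] //;
  solve [constructor 1; exact: val_inj | constructor 2; exact: val_inj
        | constructor 3; exact: val_inj | constructor 4; exact: val_inj].
Qed.

Lemma Z4_add11 (i : 'Z_4) : i + 1 + 1 = i + 2.
Proof. by rewrite -addrA; congr (_ + _); exact: val_inj. Qed.

Lemma Z4_add21 (i : 'Z_4) : i + 2 + 1 = i + 3.
Proof. by rewrite -addrA; congr (_ + _); exact: val_inj. Qed.

Lemma Z4_add31 (i : 'Z_4) : i + 3 + 1 = i.
Proof. by rewrite -addrA -[RHS]addr0; congr (_ + _); exact: val_inj. Qed.

Lemma Z4_add22 (i : 'Z_4) : i + 2 + 2 = i.
Proof. by rewrite -addrA -[RHS]addr0; congr (_ + _); exact: val_inj. Qed.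

Lemma Z4_add12 (i : 'Z_4) : i + 1 + 2 = i + 3.
Proof. by rewrite -addrA; congr (_ + _); exact: val_inj. Qed.

Lemma Z4_add13 (i : 'Z_4) : i + 1 + 3 = i.
Proof. by rewrite -addrA -[RHS]addr0; congr (_ + _); exact: val_inj. Qed.

Lemma Z4_add32 (i : 'Z_4) : i + 3 + 2 = i + 1.
Proof. by rewrite -addrA; congr (_ + _); exact: val_inj. Qed.

Lemma Z4_add23 (i : 'Z_4) : i + 2 + 3 = i + 1.
Proof. by rewrite -addrA; congr (_ + _); exact: val_inj. Qed.

Lemma Z4_add33 (i : 'Z_4) : i + 3 + 3 = i + 2.
Proof. by rewrite -addrA; congr (_ + _); exact: val_inj. Qed.

Definition Z4E := (Z4_add11, Z4_add21, Z4_add31, Z4_add22, Z4_add12, Z4_add13,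
  Z4_add32, Z4_add23, Z4_add33).

Lemma Z4_neqE (i : 'Z_4) :
  ((i == i + 1) = false) * ((i == i + 2) = false) * ((i == i + 3) = false).
Proof. by case: i => [[|[|[|[|?]]]] ?]. Qed.

End Colors.

(** * Arcs and colors around a vertex *)

Section Decomposition.
Local Open Scope ring_scope.
Variables (G : plane_graph) (vs : vertex G) (r : 'Z_4 -> dart (edge G)).
Variable A : 'Z_4 -> {set dart (edge G)}.
Hypothesis reg4 : regular_of_degree G 4.
Hypothesis rootE : root_edges vs r.
Hypothesis dec : regular_decomposition vs r A.
Hypothesis even : even_decomposition vs A.

Local Notation V := (vertex G).
Local Notation E := (edge G).
Local Notation D := (dart (edge G)).
Local Notation cw := ((ccw G)^-1%g).
Implicit Types (d : D) (v : V) (i j k : 'Z_4).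

Lemma card_porbit_ccw d : #|porbit (ccw G) d| = 4%N.
Proof.
transitivity #|[set d' : D | source d' == source d]|; last exact: reg4.
have -> // : porbit (ccw G) d = [set d' : D | source d' == source d]; apply/setP => d'.
by rewrite inE -source_ccw eq_sym.
Qed.

Lemma darts_at d d' : source d' = source d ->
  [\/ d' = d, d' = cw d, d' = cw (cw d) | d' = cw (cw (cw d))].
Proof.
move=> /esym/eqP; rewrite source_ccw -porbitV porbit_traject porbitV card_porbit_ccw.
rewrite !inE => /or4P [] /eqP ->; by constructor.
Qed.

Lemma source_r i : source (r i) = vs.
Proof. by case: (rootE i). Qed.

Lemma cw_r i : cw (r (i + 1)) = r i.
Proof. by case: (rootE i) => _ ->; rewrite permK. Qed.

Lemma target_r i : target (r i) != vs.
Proof. by rewrite -(source_r i) /target eq_sym loopless. Qed.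

Lemma root_dart d : source d = vs -> exists i, d = r i.
Proof.
rewrite -(source_r 0) => /darts_at.
have E1 : cw (r 0) = r 3.
  by have <- : 3 + 1 = 0 :> 'Z_4; [exact: val_inj|exact: cw_r].
have E2 : cw (r 3) = r 2.
  by have <- : 2 + 1 = 3 :> 'Z_4; [exact: val_inj|exact: cw_r].
have E3 : cw (r 2) = r 1.
  by have <- : 1 + 1 = 2 :> 'Z_4; [exact: val_inj|exact: cw_r].
by rewrite E1 E2 E3; case=> ->; eexists.
Qed.

Lemma tree_edgesP (B : {set D}) d :
  (d.1 \in tree_edges B) = (d \in B) || (rev_dart d \in B).
Proof.
apply/imsetP/orP => [[d' d'B e]|].
  case: d d' e d'B => e [] [e' []] /= <- Hd; rewrite /rev_dart /=; tauto.
by case=> H; eexists; eauto.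
Qed.

Lemma edges_atE d v : (d.1 \in edges_at v) = (source d == v) || (target d == v).
Proof.
apply/imsetP/orP => [[d'] |].
  rewrite inE => sd' e; case: d d' e sd' => e [] [e' []] /= <-;
  by rewrite /target /rev_dart /=; tauto.
by case=> H; [exists d|exists (rev_dart d)]; rewrite ?inE.
Qed.

Lemma arc_anti i d : d \in A i -> rev_dart d \notin A i.
Proof. by case: dec => /(_ i) [_ H _] _ _ _; exact: H. Qed.

Lemma root_edge_tree i j : ((r i).1 \in tree_edges (A j)) = (j == i).
Proof. by case: dec. Qed.

Lemma arc_cw i d : d \in A i -> source d != vs -> cw d \in A (i + 1).
Proof. by case: dec => _ _ _ H; exact: H. Qed.

Lemma exists_out i v : v != vs -> exists2 d, d \in A i & source d = v.
Proof.
have [/(_ i) [_ _ /(_ v) conn] _ _ _] := dec; have /connectP [p] := conn.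
case: p => [|u p] /=; first by move=> _ ->; rewrite eqxx.
by case/andP=> /exists_inP [d dA /andP [/eqP <- _]] _ _; exists d.
Qed.

(** Turning clockwise from an arc of color 0 meets all four darts at the vertex, one of each
    color. *)
Lemma dart_covered d : source d != vs -> exists i, d \in A i.
Proof.
move=> dn; have [d0 d0A sd] := exists_out 0 dn.
have n0 : source d0 != vs by rewrite sd.
have A1 := arc_cw d0A n0.
have n1 : source (cw d0) != vs by rewrite source_ccwV.
have A2 := arc_cw A1 n1.
have n2 : source (cw (cw d0)) != vs by rewrite source_ccwV.
have A3 := arc_cw A2 n2.
by case: (darts_at (esym sd)) => ->; [exists 0|exists (0 + 1)|exists (0 + 1 + 1)|exists (0 + 1 +
  1 + 1)].
Qed.

Lemma rev_r_arc i : rev_dart (r i) \in A i.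
Proof.
have [j rj] := dart_covered (target_r i).
by have := root_edge_tree i j; rewrite tree_edgesP rj orbT => /esym/eqP ji; rewrite -{2}ji.
Qed.

Lemma arc_source i d : d \in A i -> source d != vs.
Proof.
move=> dA; apply/eqP => /root_dart [j dE]; subst d.
have := root_edge_tree j i; rewrite tree_edgesP dA => /esym/eqP E; rewrite E in dA.
by have := arc_anti (rev_r_arc j); rewrite rev_dartK dA.
Qed.

Lemma arc_color_uniq i j d : d \in A i -> d \in A j -> i = j.
Proof.
move=> di dj; have dn := arc_source di.
case: (eqVneq (target d) vs) => [/root_dart [k kE]|tn].
  have: (r k).1 \in tree_edges (A i) by rewrite -kE tree_edgesP rev_dartK di orbT.
  have: (r k).1 \in tree_edges (A j) by rewrite -kE tree_edgesP rev_dartK dj orbT.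
  by rewrite !root_edge_tree => /eqP -> /eqP ->.
case: dec => _ /(_ d.1) + _ _.
rewrite edges_atE negb_or dn tn => /(_ isT) [i0 [j0 [ij tA fA kE]]].
apply/eqP/negPn/negP => /eqP neq.
have di' : d.1 \in tree_edges (A i) by rewrite tree_edgesP di.
have dj' : d.1 \in tree_edges (A j) by rewrite tree_edgesP dj.
have [dA0 dA1] : d \in A i0 /\ d \in A j0.
  by case: (kE _ di') => ?; case: (kE _ dj') => ?; subst.
case: d {dn tn di dj di' dj' kE} tA fA dA0 dA1 => e [] /= tA fA dA0 dA1.
- by have := arc_anti dA1; rewrite fA.
- by have := arc_anti dA0; rewrite tA.
Qed.

(** Only the darts that leave [vs] get the default 0; hence the conditions [source d != vs]
    below. *)
Definition col d : 'Z_4 := odflt 0 [pick i | d \in A i].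

Lemma arcE i d : source d != vs -> (d \in A i) = (col d == i).
Proof.
move=> dn; rewrite /col; case: pickP => [j dj|no] /=; last first.
  by have [j] := dart_covered dn; rewrite no.
by apply/idP/eqP => [/(arc_color_uniq dj)//|<-].
Qed.

Lemma colP d : source d != vs -> d \in A (col d).
Proof. by move=> dn; rewrite arcE. Qed.

Lemma col_arc i d : d \in A i -> col d = i.
Proof. by move=> dA; apply/eqP; rewrite -arcE // (arc_source dA). Qed.

Lemma col_cw d : source d != vs -> col (cw d) = col d + 1.
Proof. by move=> dn; apply: col_arc; apply: arc_cw => //; apply: colP. Qed.

Lemma col_rev_r i : col (rev_dart (r i)) = i.
Proof. exact/col_arc/rev_r_arc. Qed.

Lemma col_inj d d' : source d != vs -> source d = source d' -> col d = col d' ->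
  d = d'.
Proof.
move=> dn sd; have dn' i : source (cw d) != vs by rewrite source_ccwV.
have E1 : col (cw d) = col d + 1 by rewrite col_cw.
have E2 : col (cw (cw d)) = col d + 2 by rewrite col_cw ?source_ccwV // E1 Z4_add11.
have E3 : col (cw (cw (cw d))) = col d + 3 by rewrite col_cw ?source_ccwV // E2 Z4_add21.
case: (darts_at (esym sd)) => d'E; rewrite d'E //.
- by rewrite E1 => /eqP; rewrite Z4_neqE.
- by rewrite E2 => /eqP; rewrite Z4_neqE.
- by rewrite E3 => /eqP; rewrite Z4_neqE.
Qed.

(** Evenness enters here: the two trees through an edge have indices of different parities. *)
Lemma col_rev d : source d != vs -> target d != vs ->
  col (rev_dart d) = col d + 1 \/ col (rev_dart d) = col d + 3.
Proof.
move=> dn tn; apply: Z4_odd.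
have en : d.1 \notin edges_at vs by rewrite edges_atE negb_or dn tn.
apply: (even en); rewrite ?tree_edgesP ?colP ?orbT //.
have := arc_anti (colP dn); rewrite arcE //; by rewrite eq_sym.
Qed.

Definition out i v : D := odflt (r i) [pick d | (d \in A i) && (source d == v)].

Lemma outP i v : v != vs -> out i v \in A i /\ source (out i v) = v.
Proof.
move=> vn; rewrite /out; case: pickP => [d /andP [? /eqP] //|no].
by have [d dA sd] := exists_out i vn; have := no d; rewrite dA sd eqxx.
Qed.

Lemma source_out i v : v != vs -> source (out i v) = v.
Proof. by move=> /(outP i) []. Qed.

Lemma col_out i v : v != vs -> col (out i v) = i.
Proof. by move=> /(outP i) [/col_arc]. Qed.

Lemma out_col d : source d != vs -> out (col d) (source d) = d.
Proof. by move=> dn; apply: col_inj; rewrite ?source_out ?col_out. Qed.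

Lemma arc_out i d : d \in A i -> d = out i (source d).
Proof. by move=> dA; rewrite -(col_arc dA) out_col // (arc_source dA). Qed.

Lemma cw_out i v : v != vs -> cw (out i v) = out (i + 1) v.
Proof.
move=> vn; apply: col_inj; rewrite ?source_ccwV ?source_out //.
by rewrite col_cw ?col_out // source_out.
Qed.

Lemma col_face_perm d : target d != vs ->
  col (face_perm (ccw G) d) = col (rev_dart d) + 1.
Proof. by move=> tn; rewrite face_permE col_cw. Qed.

Definition par i v : V := if v == vs then vs else target (out i v).

Lemma parE i v : v != vs -> par i v = target (out i v).
Proof. by rewrite /par => /negPf ->. Qed.

Lemma par_arc i v w : arc_rel (A i) v w -> v != vs /\ par i v = w.
Proof.
case/exists_inP=> d dA /andP [/eqP sd /eqP td].
have vn : v != vs by rewrite -sd (arc_source dA).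
by split; rewrite ?parE // -sd -(arc_out dA).
Qed.

Lemma arc_par i v : v != vs -> arc_rel (A i) v (par i v).
Proof.
move=> vn; apply/exists_inP; exists (out i v); first by case: (outP i vn).
by rewrite source_out // parE // !eqxx.
Qed.

Lemma par_reaches i v : exists n, iter n (par i) v == vs.
Proof.
have [/(_ i) [_ _ /(_ v) conn] _ _ _] := dec; have /connectP [p] := conn.
elim: p v {conn} => [|u p IH] v /=; first by move=> _ ->; exists 0%N => /=.
by case/andP=> /par_arc [_ <-] pp lp; have [n nE] := IH _ pp lp; exists n.+1; rewrite iterSr.
Qed.

Definition dep i v : nat := ex_minn (par_reaches i v).

Lemma dep_par i v : v != vs -> dep i v = (dep i (par i v)).+1.
Proof.
move=> vn; rewrite {1}/dep; case: ex_minnP => m mE mmin.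
rewrite /dep; case: ex_minnP => m' m'E m'min.
case: m mE mmin => [|m] mE mmin; first by move: mE; rewrite /= (negPf vn).
rewrite iterSr in mE; apply/eqP; rewrite eqSS eqn_leq m'min // andbT -ltnS.
by apply: mmin; rewrite iterSr.
Qed.

Lemma tree_ind i (P : V -> Prop) : P vs ->
  (forall v, v != vs -> P (par i v) -> P v) -> forall v, P v.
Proof.
move=> P0 PS v; have [n] := ubnP (dep i v); elim: n v => // n IH v.
case: (eqVneq v vs) => [->//|vn]; rewrite dep_par // ltnS => le.
by apply: PS => //; apply: IH.
Qed.

(** * Flows along the tree paths and their potentials *)

Definition on_path i v d : bool := (d \in A i) && connect (arc_rel (A i)) v (source d).

Lemma connect_root i w : connect (arc_rel (A i)) vs w -> w = vs.
Proof. by case/connectP=> -[|u p] //= /andP [/par_arc []]; rewrite eqxx. Qed.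

Lemma connect_par i v w : v != vs ->
  connect (arc_rel (A i)) v w = (v == w) || connect (arc_rel (A i)) (par i v) w.
Proof.
move=> vn; apply/idP/orP => [/connectP [[|u p] /=]|].
- by move=> _ ->; left.
- by case/andP=> /par_arc [_ <-] pp lp; right; apply/connectP; exists p.
case=> [/eqP <-|]; first exact: connect0.
by apply: connect_trans; apply: connect1; apply: arc_par.
Qed.

Lemma connect_dep i v w : connect (arc_rel (A i)) v w ->
  (dep i w < dep i v)%N || (v == w).
Proof.
elim/(@tree_ind i): v => [/connect_root ->|v vn IH]; first by rewrite eqxx orbT.
rewrite connect_par // => /orP [->|/IH]; first by rewrite orbT.
rewrite (dep_par _ vn) => /orP [/ltnW lt|/eqP ->]; by rewrite ltnS ?lt ?leqnn.
Qed.

Lemma on_root i d : on_path i vs d = false.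
Proof.
apply/negP=> /andP [dA /connect_root sd].
by have := arc_source dA; rewrite sd eqxx.
Qed.

Lemma on_step i v d : v != vs -> on_path i v d = (d == out i v) || on_path i (par i v) d.
Proof.
move=> vn; rewrite /on_path connect_par //.
have -> : (d == out i v) = (d \in A i) && (v == source d).
  apply/eqP/andP => [->|[dA /eqP ->]]; last exact: arc_out.
  by case: (outP i vn) => -> ->.
by case: (d \in A i).
Qed.

(** Depth decreases along the path, so its first arc is not met again. *)
Lemma on_par_out i v : v != vs -> on_path i (par i v) (out i v) = false.
Proof.
move=> vn; apply/negP => /andP [_ /connect_dep].
rewrite source_out // (dep_par _ vn) => /orP [|/eqP e].
  by rewrite ltnNge leqnSn.
by have := dep_par i vn; rewrite e => /eqP; rewrite -{1}[dep i v]addn0 -addn1 eqn_add2l.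
Qed.

Lemma on_out i v : v != vs -> on_path i v (out i v).
Proof. by move=> vn; rewrite on_step // eqxx. Qed.

Lemma on_arc i v d : on_path i v d -> d \in A i.
Proof. by case/andP. Qed.

Lemma arc_rev_col i j d : d \in A i -> rev_dart d \in A j -> j = i + 1 \/ j = i + 3.
Proof.
move=> di dj; rewrite -(col_arc di) -(col_arc dj); apply: col_rev (arc_source di) _.
exact: arc_source dj.
Qed.

Definition arcflow (o d : D) : rat := (d == o)%:R - (rev_dart d == o)%:R.

Lemma rev_eq d d' : (rev_dart d == d') = (d == rev_dart d').
Proof. by rewrite (can2_eq (@rev_dartK G) (@rev_dartK G)). Qed.

Lemma arcflow_revl o d : arcflow (rev_dart o) d = - arcflow o d.
Proof. by rewrite /arcflow opprB !rev_eq rev_dartK. Qed.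

Lemma sum_source_eq (F : D -> rat) v o :
  \sum_(d | source d == v) (d == o)%:R * F d = (source o == v)%:R * F o.
Proof.
rewrite big_mkcond (bigD1 o) //= eqxx mul1r big1 ?addr0; first by case: ifP;
  rewrite ?(mul1r, mul0r).
by move=> d /negPf ->; rewrite mul0r; case: ifP.
Qed.

Lemma arcflow_div o v :
  \sum_(d | source d == v) arcflow o d = (source o == v)%:R - (target o == v)%:R.
Proof.
rewrite /arcflow sumrB; congr (_ - _).
  by have := sum_source_eq (fun=> 1) v o; under eq_bigr do rewrite mulr1; rewrite mulr1.
have := sum_source_eq (fun=> 1) v (rev_dart o).
by under eq_bigr do rewrite mulr1 -rev_eq; rewrite mulr1.
Qed.

Definition path_flow i v d : rat := (on_path i v d)%:R - (on_path i v (rev_dart d))%:R.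

Lemma path_flow_rev i v d : path_flow i v (rev_dart d) = - path_flow i v d.
Proof. by rewrite /path_flow rev_dartK opprB. Qed.

Lemma path_flow_root i d : path_flow i vs d = 0.
Proof. by rewrite /path_flow !on_root subrr. Qed.

Lemma path_flow_step i v d : v != vs -> path_flow i v d = arcflow (out i v) d + path_flow i (par
  i v) d.
Proof.
move=> vn; rewrite /path_flow /arcflow !(on_step _ _ vn).
have disj e : (e == out i v) && on_path i (par i v) e = false.
  by apply/andP => -[/eqP ->]; rewrite on_par_out.
have := disj d; have := disj (rev_dart d).
by do 4![case: (X in is_true X -> _) || case: (_ == _) || case: (on_path _ _ _)] => //=; lra.
Qed.

Lemma path_flow_div i v u :
  \sum_(d | source d == u) path_flow i v d = (v == u)%:R - (vs == u)%:R.
Proof.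
elim/(@tree_ind i): v => [|v vn IH].
  by rewrite big1 ?subrr // => d _; rewrite path_flow_root.
rewrite (eq_bigr _ (fun d _ => path_flow_step i d vn)) big_split /= IH arcflow_div.
by rewrite source_out // -parE // addrA subrK.
Qed.

Lemma path_flow_0 i v d : d \notin A i -> rev_dart d \notin A i -> path_flow i v d = 0.
Proof. by move=> d0 d1; rewrite /path_flow /on_path (negPf d0) (negPf d1) subrr. Qed.

Lemma on_rev_r i v : v != vs -> on_path i v (rev_dart (r i)).
Proof.
elim/(@tree_ind i): v => [|v vn IH _]; first by rewrite eqxx.
rewrite on_step //; case: (eqVneq (par i v) vs) => [e|/IH ->]; last by rewrite orbT.
have [j jE] : exists j, rev_dart (out i v) = r j by apply: root_dart; rewrite -[LHS]parE.
have ij : i = j by rewrite -(col_rev_r j) -jE rev_dartK col_out.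
by rewrite -[out _ _]rev_dartK jE -ij eqxx.
Qed.

Lemma path_flow_r i j v : v != vs -> path_flow i v (r j) = - (j == i)%:R.
Proof.
move=> vn; rewrite /path_flow; have -> : on_path i v (r j) = false.
  by apply/negP => /on_arc /arc_source; rewrite source_r eqxx.
rewrite sub0r; congr (- (nat_of_bool _)%:R).
have [->|ne] := eqVneq j i; first by rewrite on_rev_r.
apply/negbTE/negP => /on_arc dA; have e := arc_color_uniq (rev_r_arc j) dA.
by rewrite e eqxx in ne.
Qed.

(** One unit goes from [v] to the root along [P_(i+2)(v)] and back against [P_i(v)], with the region
    [R_(i,i+2)(v)] on its left. *)
Definition cycle_flow i v d : rat := path_flow (i + 2) v d - path_flow i v d.

Lemma cycle_flow_circ i v : circulation (cycle_flow i v).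
Proof.
split=> [d|u]; first by rewrite /cycle_flow !path_flow_rev; ring.
by rewrite sumrB !path_flow_div subrr.
Qed.

(** The value 1 at [r (i + 1)] fixes the additive constant, this root-edge being in the region. For
    finite functions the conditions are boolean, so [xchoose] can pick the potential. *)
Lemma pot_exists i v : exists h : {ffun D -> rat},
  [&& [forall d, h (face_perm (ccw G) d) == h d],
      [forall d, jump h d == cycle_flow i v d] & h (r (i + 1)) == 1].
Proof.
have [h hh jh] := circulation_potential (cycle_flow_circ i v).
exists [ffun d => h d - h (r (i + 1)) + 1]; apply/and3P; split.
- by apply/forallP => d; rewrite !ffunE hh.
- by apply/forallP => d; rewrite -jh /jump !ffunE; apply/eqP; ring.
by rewrite ffunE subrr add0r.
Qed.

Definition pot i v : {ffun D -> rat} := xchoose (pot_exists i v).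

Lemma pot_ff i v : facefun (pot i v).
Proof. by move=> d; have /and3P [/forallP/(_ d)/eqP] := xchooseP (pot_exists i v). Qed.

Lemma pot_jump i v d : jump (pot i v) d = cycle_flow i v d.
Proof. by have /and3P [_ /forallP/(_ d)/eqP] := xchooseP (pot_exists i v). Qed.

Lemma pot_rev i v d : pot i v (rev_dart d) = pot i v d - cycle_flow i v d.
Proof. by rewrite -pot_jump /jump; ring. Qed.

Lemma pot_r1 i v : pot i v (r (i + 1)) = 1.
Proof. by have /and3P [_ _ /eqP] := xchooseP (pot_exists i v). Qed.

(** At the root the cycle flow only uses the root-edges [i] and [i + 2]. So the root-faces on the
    left of [r i], [r (i + 1)] will get the value 1 and the other two the value 0, for every [v]. *)
Lemma pot_rS i v j : v != vs ->
  pot i v (r (j + 1)) = pot i v (r j) + (j + 1 == i)%:R - (j + 1 == i + 2)%:R.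
Proof.
move=> vn; rewrite -(cw_r j) (facefun_ccwV _ (pot_ff i v)) pot_rev /cycle_flow !path_flow_r //;
  ring.
Qed.

Lemma pot_r0 i v : v != vs -> pot i v (r i) = 1.
Proof.
move=> vn; have := pot_rS i i vn; rewrite pot_r1 -Z4_add11 Z4_neqE.
by rewrite [_ == i]eq_sym Z4_neqE addr0 subr0.
Qed.

Lemma pot_r2 i v : v != vs -> pot i v (r (i + 2)) = 0.
Proof.
move=> vn; rewrite -Z4_add11 pot_rS // pot_r1 Z4_add11 eqxx [_ == i]eq_sym Z4_neqE.
by rewrite addr0 subrr.
Qed.

Lemma pot_r3 i v : v != vs -> pot i v (r (i + 3)) = 0.
Proof.
move=> vn; rewrite -Z4_add21 pot_rS // pot_r2 // Z4_add21 [_ == i]eq_sym Z4_neqE.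
by rewrite -Z4_add21 [_ == i + 2]eq_sym Z4_neqE addr0 subrr.
Qed.

Lemma pot_roots i v w j : v != vs -> w != vs -> pot i v (r j) = pot i w (r j).
Proof.
by move=> vn wn; case: (Z4_cases i j) => ->; rewrite ?pot_r0 ?pot_r1 ?pot_r2 ?pot_r3.
Qed.

Lemma facefun_eq (g h : D -> rat) d0 : facefun g -> facefun h ->
  (forall d, jump g d = jump h d) -> g d0 = h d0 -> g =1 h.
Proof.
move=> gg hh j0 e d.
have ff : facefun (fun x => g x - h x) by move=> x; rewrite gg hh.
have jz x : jump (fun x => g x - h x) x = 0.
  have := j0 x; rewrite /jump => ?; lra.
by have := facefun_const ff jz d d0; rewrite e subrr => /eqP; rewrite subr_eq0 => /eqP.
Qed.

(** Exchanging the two paths reverses the cycle flow; one root-face fixes the constant. *)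
Lemma pot_compl i v d : v != vs -> pot (i + 2) v d = 1 - pot i v d.
Proof.
move=> vn.
apply: (@facefun_eq _ (fun d => 1 - pot i v d) (r (i + 1)) (pot_ff _ _)).
- by move=> x; rewrite pot_ff.
- move=> x; rewrite pot_jump /jump pot_rev /cycle_flow Z4E; ring.
by rewrite pot_r1 subrr -{1}(Z4_add23 i) pot_r3.
Qed.

(** Induction from the deepest vertices up: every other dart at [v] that could carry flow is the
    reverse of an arc from a child, which carries none, so conservation kills the arc that leaves
    [v]. *)
Lemma tree_circulation0 k chi : circulation chi ->
  (forall d, d \notin A k -> rev_dart d \notin A k -> chi d = 0) ->
  forall d, chi d = 0.
Proof.
case=> anti div chi0.
pose N := \max_(v : V) dep k v.
have key v : v != vs -> chi (out k v) = 0.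
  have [n] := ubnP (N - dep k v)%N; elim: n v => // n IH v ltn vn.
  rewrite -[RHS](div v) (bigD1 (out k v)) /=; last by rewrite source_out.
  rewrite big1 ?addr0 // => d /andP [/eqP sd dn].
  case: (boolP (rev_dart d \in A k)) => [dA|]; last first.
    apply: chi0; apply: contra dn => dA; by rewrite (arc_out dA) sd.
  rewrite -[d]rev_dartK anti (arc_out dA) IH ?oppr0 ?(arc_source dA) //.
  have e : par k (source (rev_dart d)) = v.
    by rewrite parE ?(arc_source dA) // -(arc_out dA) /target rev_dartK.
  have := dep_par k (arc_source dA); rewrite e => dE.
  have : (dep k (source (rev_dart d)) <= N)%N by apply: leq_bigmax.
  lia.
move=> d; case: (boolP (d \in A k)) => [dA|d1].
  by rewrite (arc_out dA) key // (arc_source dA).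
case: (boolP (rev_dart d \in A k)) => [dA|d2]; last exact: chi0.
by rewrite -[d]rev_dartK anti (arc_out dA) key ?oppr0 // (arc_source dA).
Qed.

(* The jump of the indicator of a level set of [h] is a multiple of the jump of [h],
   since a circulation supported on a tree vanishes. *)
Lemma two_valued (h : D -> rat) k g : facefun h -> jump h g != 0 ->
  (forall d, d != g -> d != rev_dart g -> d \notin A k -> rev_dart d \notin A k ->
     jump h d = 0) ->
  forall d, h d = h g \/ h d = h (rev_dart g).
Proof.
move=> hh jg supp.
pose gam d : rat := (h d == h g)%:R.
have gg : facefun gam by move=> d; rewrite /gam hh.
(* [kap] is chosen so that [chi] vanishes at [g]; what remains is supported on the tree [k]. *)
pose kap := jump gam g / jump h g.
pose chi d := jump gam d - kap * jump h d.
have cc : circulation chi.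
  have [a1 s1] := jump_circ gg; have [a2 s2] := jump_circ hh.
  split=> [d|v]; first by rewrite /chi a1 a2; ring.
  by rewrite /chi sumrB -mulr_sumr s1 s2 mulr0 subrr.
have chig : chi g = 0 by rewrite /chi /kap divfK // subrr.
have chi0 : forall d, chi d = 0.
  apply: (tree_circulation0 (k := k)) => // d d1 d2.
  case: (eqVneq d g) => [->//|n1].
  case: (eqVneq d (rev_dart g)) => [->|n2]; first by case: cc => -> _; rewrite chig oppr0.
  have := supp _ n1 n2 d1 d2; rewrite /chi => jz; rewrite jz mulr0 subr0.
  move: jz; rewrite /jump /gam => /eqP; rewrite subr_eq0 => /eqP ->; by rewrite subrr.
have gnr : h (rev_dart g) != h g.
  by apply: contra jg => /eqP e; rewrite /jump e subrr.
have kE : kap * jump h g = 1.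
  by rewrite /kap divfK // /jump /gam eqxx (negPf gnr) subr0.
have aff d d' : gam d - kap * h d = gam d' - kap * h d'.
  apply: (@facefun_const _ (fun x => gam x - kap * h x)) => [x|x]; first by rewrite gg hh.
  by rewrite -[RHS](chi0 x) /chi /jump; ring.
move=> d; case: (eqVneq (h d) (h g)) => [->|ne]; [by left|right].
have := aff d (rev_dart g); rewrite /gam (negPf ne) (negPf gnr) => /eqP.
rewrite !sub0r eqr_opp => /eqP; apply: mulfI.
by apply/eqP => k0; move: kE; rewrite k0 mul0r => /eqP; rewrite eq_sym oner_eq0.
Qed.

(** * Monotonicity along arcs *)

Lemma out_cw_left i v : v != vs -> cw (out (i + 3) v) = out i v.
Proof. by move=> vn; rewrite cw_out // Z4_add31. Qed.

(** The value 0 is carried up the tree from the root. At the parent of [z], the reverse of [out j z]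
    has color [j + 1] or [j + 3], so it is next to the arc of color [j] in the rotation: the two
    arcs share a face, and no jump separates the sides of either. *)
Lemma sides_zero (h : D -> rat) j a : facefun h -> (forall m, h (r m) = 0) ->
  (forall z, z != vs -> (dep j z <= dep j a)%N -> jump h (out j z) = 0) ->
  a != vs -> h (out j a) = 0.
Proof.
move=> hh hr j0; have rv z : z != vs -> (dep j z <= dep j a)%N ->
    h (rev_dart (out j z)) = h (out j z).
  by move=> zn dz; have /eqP := j0 z zn dz; rewrite /jump subr_eq0 => /eqP.
suff: forall z, z != vs -> (dep j z <= dep j a)%N -> h (out j z) = 0.
  by move=> K an; apply: K.
elim/(@tree_ind j) => [|z zn IH _ dz]; first by rewrite eqxx.
have sg : source (rev_dart (out j z)) = par j z by rewrite parE.
rewrite -rv //; have [pz|pn] := eqVneq (par j z) vs.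
  by have [m ->] := root_dart (etrans sg pz).
have dz' : (dep j (par j z) <= dep j a)%N.
  by apply: leq_trans dz; rewrite (dep_par j zn) leqnSn.
have IH' := IH pn dz'.
have gn : source (rev_dart (out j z)) != vs by rewrite sg.
have := out_col gn; rewrite sg.
have := @col_rev (out j z); rewrite source_out // col_out // => /(_ zn).
rewrite -parE // => /(_ pn) [] -> gE.
  by rewrite -gE -cw_out // (facefun_ccwV _ hh) rv.
rewrite rv // -[out j z]rev_dartK -(facefun_ccwV _ hh) -gE out_cw_left //.
Qed.

Lemma facefun_sub (g h : D -> rat) : facefun g -> facefun h ->
  facefun (fun d => g d - h d).
Proof. by move=> gg hh d; rewrite gg hh. Qed.

(* The difference [h] of the two potentials vanishes along [P_j(a)], where [j] is the
   color of the edge as an arc leaving the parent; this tells on which side of the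
   edge [h] is 0. *)
Lemma pot_arc i a : a != vs -> par (i + 1) a != vs ->
  (forall d, pot i a d = pot i (par (i + 1) a) d \/ pot i a d = pot i (par (i + 1) a) d + 1) /\
  (exists d, pot i a d = pot i (par (i + 1) a) d + 1).
Proof.
move=> an bn; set b := par (i + 1) a in bn *.
pose e := out (i + 1) a; pose g := rev_dart e.
have te : target e = b by rewrite /b parE.
have sg : source g = b by [].
have gn : source g != vs by rewrite sg.
have tg : target g = a by rewrite /target rev_dartK source_out.
have en : source e != vs by rewrite source_out.
pose h d := pot i a d - pot i b d.
have hh : facefun h by apply: facefun_sub; apply: pot_ff.
have hr m : h (r m) = 0 by rewrite /h (pot_roots _ _ an bn) subrr.
have jh d : jump h d = cycle_flow i a d - cycle_flow i b d.
  by rewrite -!pot_jump /h /jump; ring.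
have ce : col e = i + 1 by rewrite col_out.
have cg : col g = i \/ col g = i + 2.
  have := @col_rev e; rewrite te ce => /(_ en bn); rewrite !Z4E; tauto.
have gE : out (col g) b = g by rewrite -{1}sg out_col.
have pb : par (col g) b = a by rewrite parE // gE tg.
have db := dep_par (col g) bn; rewrite pb in db.
have pfb d : path_flow (col g) b d = arcflow g d + path_flow (col g) a d.
  by rewrite path_flow_step // gE pb.
have notA k d : d \in A k -> rev_dart d \in A (k + 2) -> False.
  move=> H1 H2; case: (arc_rev_col H1 H2) => /eqP.
    by rewrite -Z4_add11 eq_sym Z4_neqE.
  by rewrite -Z4_add21 Z4_neqE.
(* The sign [s] is 1 when [g] has color [i] and -1 when it has color [i + 2]. The arc [g] begins a
   path from [b] that continues as the path from [a], so these two paths cancel except on [g]. *)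
have jg (s : rat) : s != 0 ->
    (forall d, jump h d = s * (arcflow g d + path_flow (col g + 2) a d - path_flow (col g + 2) b
      d)) ->
    [/\ h (out (col g) a) = 0, jump h (out (col g) a) = 0, jump h g = s
      & forall d, h d = h g \/ h d = h (rev_dart g)].
  move=> sn js.
  have gA : g \in A (col g) by rewrite colP.
  have pf0 d w : d \in A (col g) -> path_flow (col g + 2) w d = 0.
    move=> dA; apply: path_flow_0; last by apply/negP; apply: notA dA.
    apply/negP => dA'; have := arc_color_uniq dA dA' => /eqP.
    by rewrite Z4_neqE.
  have jgE : jump h g = s.
    rewrite js !pf0 // subr0 addr0 /arcflow eqxx.
    rewrite (_ : rev_dart g == g = false) ?subr0 ?mulr1 //.
    by apply/negP => /eqP E; have := source_rev_neq g; rewrite E eqxx.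
  have jo z : z != vs -> (dep (col g) z <= dep (col g) a)%N -> jump h (out (col g) z) = 0.
    move=> zn dz; have [zA sz] := outP (col g) zn.
    rewrite js !pf0 // subr0 addr0 /arcflow.
    case: eqP => [E|_]; first by move: dz; rewrite -sz E sg db ltnn.
    case: eqP => [E|_]; last by rewrite subrr mulr0.
    by have := arc_anti zA; rewrite E gA.
  split=> //; [exact: (sides_zero hh hr jo an)|exact: jo|].
  apply: (two_valued (k := col g + 2)) => //; first by rewrite jgE.
  move=> d n1 n2 d1 d2; rewrite js !path_flow_0 // subr0 addr0 /arcflow (negPf n1).
  by rewrite rev_eq (negPf n2) subrr mulr0.
suff [h0 h1] : (forall d, h d = 0 \/ h d = 1) /\ (exists d, h d = 1).
  split=> [d|]; first by case: (h0 d); rewrite /h => ?; [left|right]; lra.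
  by case: h1 => d; rewrite /h => ?; exists d; lra.
have ge : rev_dart g = e by rewrite /g rev_dartK.
case: cg => cg.
- have js d : jump h d = 1 * (arcflow g d + path_flow (col g + 2) a d - path_flow (col g + 2) b
  d).
    by rewrite jh /cycle_flow cg -[in path_flow i b]cg pfb cg; ring.
  have [] := jg 1 (oner_neq0 _) js; rewrite cg => z0 j0 jg1 tv.
  (* Clockwise at [a], the arc [e] comes between the arcs of colors [i] and [i + 2]. It shares a
     face with the former, where [h] is 0; in the other case the latter plays this role. *)
  have he : h e = 0.
    rewrite /e -cw_out // (facefun_ccwV _ hh).
    by move: j0; rewrite /jump z0; lra.
  have hg : h g = 1 by move: jg1; rewrite /jump ge he; lra.
  by split; [move=> d; rewrite -he -hg -ge; case: (tv d); tauto | exists g].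
- have js d : jump h d = -1 * (arcflow g d + path_flow (col g + 2) a d - path_flow (col g + 2) b
  d).
    by rewrite jh /cycle_flow cg -[in path_flow (i + 2) b]cg pfb cg Z4E; ring.
  have N1 : -1 != 0 :> rat by rewrite oppr_eq0 oner_neq0.
  have [] := jg _ N1 js; rewrite cg => z0 j0 jg1 tv.
  have hg : h g = 0.
    by rewrite /g -(facefun_ccwV _ hh) /e cw_out // Z4_add11.
  have he : h e = 1 by move: jg1; rewrite /jump ge hg; lra.
  by split; [move=> d; rewrite -he -hg -ge; case: (tv d); tauto | exists e].
Qed.

(** * Turns around a face *)

Local Notation fp := (face_perm (ccw G)).

Definition off_root d : bool := (source d != vs) && (target d != vs).
(* The contour of a face keeps its color at every dart except at the [tdart]s, where
   it changes by 2; exactly one of the two darts of an edge off the root is one. *)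
Definition tdart d : bool := off_root d && (col (rev_dart d) == col d + 1).

Lemma off_root_rev d : off_root (rev_dart d) = off_root d.
Proof. by rewrite /off_root /target rev_dartK andbC. Qed.

Lemma sdart_col d : off_root d -> ~~ tdart d -> col (rev_dart d) = col d + 3.
Proof.
move=> dn; rewrite /tdart dn /=; case/andP: dn => sn tn.
by case: (col_rev sn tn) => ->; rewrite ?eqxx.
Qed.

Lemma tdart_col d : tdart d -> col (rev_dart d) = col d + 1.
Proof. by case/andP=> _ /eqP. Qed.

Lemma tdart_off_root d : tdart d -> off_root d.
Proof. by case/andP. Qed.

Lemma tdart_rev d : off_root d -> tdart (rev_dart d) = ~~ tdart d.
Proof.
move=> dn; rewrite {1}/tdart off_root_rev dn rev_dartK /=.
case: (boolP (tdart d)) => [td|sd] /=.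
  by rewrite (tdart_col td) Z4E Z4_neqE.
by rewrite (sdart_col dn sd) Z4E eqxx.
Qed.

Lemma col_fp_t d : tdart d -> col (fp d) = col d + 2.
Proof. by move=> td; case/andP: (tdart_off_root td) => _ tn;
  rewrite col_face_perm // tdart_col // Z4E. Qed.

Lemma col_fp_s d : off_root d -> ~~ tdart d -> col (fp d) = col d.
Proof. by move=> dn sd; case/andP: (dn) => _ tn; rewrite col_face_perm // sdart_col // Z4E. Qed.

Lemma face_closed (P : D -> Prop) x0 : (forall x, x \in face_of x0 -> P x -> P (fp x)) ->
  P x0 -> forall x, x \in face_of x0 -> P x.
Proof.
move=> Pf P0 x /porbitP [k ->]; elim: k => [|k IH]; first by rewrite expg0 perm1.
by rewrite expgSr permM; apply: Pf => //; rewrite mem_porbit.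
Qed.

Lemma mem_face_eq d d' : (d' \in face_of d) = (face_of d' == face_of d).
Proof. by rewrite eq_porbit_mem. Qed.

Lemma fp_rev_r i : fp (rev_dart (r (i + 1))) = r i.
Proof. by rewrite face_permE rev_dartK cw_r. Qed.

(** Around the root [pot k] takes the values 1, 1, 0, 0, so a suitable [k] separates any two
    root-faces. *)
Lemma root_face_inj i j : r i \in face_of (r j) -> i = j.
Proof.
move=> ij; have E k : pot k (target (r 0)) (r i) = pot k (target (r 0)) (r j).
  exact: (facefun_face (pot_ff k _) ij).
have vn := target_r 0.
case: (Z4_cases j i) => // e; subst i.
- have := E (j + 3); have := pot_r1 (j + 3) (target (r 0)); have := pot_r2 (j + 3) vn.
  by rewrite !Z4E => -> -> /eqP; rewrite eq_sym oner_eq0.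
- by have := E j; rewrite pot_r2 // pot_r0 // => /eqP; rewrite eq_sym oner_eq0.
- by have := E j; rewrite pot_r3 // pot_r0 // => /eqP; rewrite eq_sym oner_eq0.
Qed.

Lemma nonroot_faceP (F : {set D}) : F \in faces G ->
  (F \in nonroot_faces vs) = (F \notin [set face_of (r i) | i in 'Z_4]).
Proof.
move=> FF; rewrite inE FF /=; apply/forall_inP/negP => [H0 /imsetP [i _ FE]|H0 d dF].
  by have := H0 (r i); rewrite FE porbit_id source_r eqxx => /(_ isT).
apply/eqP => /root_dart [i dE]; case: H0; apply/imsetP; exists i => //.
case/imsetP: FF dF => d0 _ -> dF; apply/eqP.
by rewrite -/(face_of d0) eq_sym -mem_face_eq -dE.
Qed.

Lemma nonroot_off_root F d : F \in nonroot_faces vs -> d \in F -> off_root d.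
Proof.
rewrite inE => /andP [/imsetP [d0 _ ->] /forall_inP FE] dF.
by rewrite /off_root FE //= -source_face_perm FE // mem_face_perm.
Qed.

Lemma nonroot_face F d : F \in nonroot_faces vs -> d \in F -> F = face_of d.
Proof.
rewrite inE => /andP [/imsetP [d0 _ ->] _]; by rewrite -/(face_of d0) mem_face_eq => /eqP.
Qed.

Definition bd (F : {set D}) d : rat := (d \in F)%:R - (rev_dart d \in F)%:R.

Lemma sum_arcflow (F : {set D}) x : \sum_(d in F) arcflow d x = bd F x.
Proof.
rewrite /arcflow sumrB /bd; congr (_ - _).
  rewrite big_mkcond (bigD1 x) //= eqxx big1 ?addr0; first by case: ifP.
  by move=> d /negPf; rewrite eq_sym => ->; case: ifP.
rewrite big_mkcond (bigD1 (rev_dart x)) //= eqxx big1 ?addr0; first by case: ifP.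
by move=> d /negPf; rewrite eq_sym => ->; case: ifP.
Qed.

Lemma sum_face_perm (R0 : zmodType) d0 (g : D -> R0) :
  \sum_(d in face_of d0) g (fp d) = \sum_(d in face_of d0) g d.
Proof.
rewrite [RHS](reindex_inj (@perm_inj _ fp)) /=.
by apply: eq_bigl => d; rewrite mem_face_perm.
Qed.

(** Each dart of the contour is the difference of the paths of its own color from its two ends.
    Around the face these differences telescope, except where the color changes by 2, which leaves a
    cycle flow. *)
Lemma face_identity_target F x : F \in nonroot_faces vs ->
  \sum_(d in F | tdart d) cycle_flow (col d) (target d) x = bd F x.
Proof.
move=> FN; have FE := nonroot_face FN; have Fn := nonroot_off_root FN.
have [d0 d0F] : exists d0, d0 \in F.
  by move: FN; rewrite inE => /andP [/imsetP [d0 _ ->] _]; exists d0; rewrite porbit_id.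
rewrite -sum_arcflow big_mkcondr /=.
rewrite (eq_bigr (fun d => path_flow (col (fp d)) (source (fp d)) x - path_flow (col d) (target
  d) x)).
  rewrite sumrB (FE _ d0F) (sum_face_perm d0 (fun d => path_flow (col d) (source d) x)) -sumrB.
  apply: eq_bigr => d; rewrite -(FE _ d0F) => /Fn /andP [sn tn].
  by rewrite path_flow_step // parE // out_col // addrK.
move=> d dF; rewrite source_face_perm; case: ifP => [td|/negbT sd].
  by rewrite col_fp_t.
by rewrite col_fp_s ?Fn // subrr.
Qed.

(** The same telescoping for the reversed darts, whose color is [col d + 3] away from the turns. *)
Lemma face_identity_source F x : F \in nonroot_faces vs ->
  \sum_(d in F | tdart d) cycle_flow (col d + 3) (source d) x = bd F x.
Proof.
move=> FN; have FE := nonroot_face FN; have Fn := nonroot_off_root FN.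
have [d0 d0F] : exists d0, d0 \in F.
  by move: FN; rewrite inE => /andP [/imsetP [d0 _ ->] _]; exists d0; rewrite porbit_id.
rewrite -sum_arcflow big_mkcondr /=.
rewrite (eq_bigr (fun d => path_flow (col (rev_dart d)) (source d) x - path_flow (col d + 3)
  (source d) x)).
  rewrite sumrB (FE _ d0F) -(sum_face_perm d0 (fun d => path_flow (col d + 3) (source d) x))
    -sumrB.
  apply: eq_bigr => d; rewrite -(FE _ d0F) => /Fn /andP [sn tn].
  rewrite source_face_perm col_face_perm // Z4E.
  have oE : out (col (rev_dart d)) (target d) = rev_dart d by rewrite out_col.
  rewrite [path_flow _ (target d) x]path_flow_step // parE // oE /target rev_dartK arcflow_revl.
  by ring.
move=> d dF; case: ifP => [td|/negbT sd].
  by rewrite /cycle_flow tdart_col // Z4E.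
by rewrite sdart_col ?Fn // subrr.
Qed.

Lemma nonroot_nonempty F : F \in nonroot_faces vs -> exists d0, d0 \in F.
Proof. by rewrite inE => /andP [/imsetP [d0 _ ->] _]; exists d0; rewrite porbit_id. Qed.

Lemma nonroot_in_faces F : F \in nonroot_faces vs -> F \in faces G.
Proof. by rewrite inE => /andP []. Qed.

Lemma bd_jump F d : bd F d = jump (fun x => (x \in F)%:R) d.
Proof. by []. Qed.

Lemma root_not_nonroot F i : F \in nonroot_faces vs -> r i \notin F.
Proof. by move=> FN; apply/negP => /(nonroot_off_root FN); rewrite /off_root source_r eqxx. Qed.

(** * Counting the turns of a face *)

Definition tcount (F : {set D}) : nat := (\sum_(d | tdart d && (d \in F)) 1)%N.

(** Without turns the face identity would give a zero boundary, so [F] would contain every dart,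
    even [r 0]. A single turn is excluded because colors must return to their initial value and each
    turn adds 2 modulo 4. *)
Lemma tcount_ge2 F : F \in nonroot_faces vs -> (2 <= tcount F)%N.
Proof.
move=> FN; have [d0 d0F] := nonroot_nonempty FN; have FE := nonroot_face FN d0F.
have tc : tcount F = #|[set d in F | tdart d]|.
  by rewrite /tcount sum1_card; apply: eq_card => d; rewrite !inE andbC.
have n0 : tcount F != 0%N.
  apply/eqP; rewrite tc => /eqP; rewrite cards_eq0 => /eqP t0.
  have j0 d : jump (fun x => (x \in F)%:R) d = 0.
    rewrite -bd_jump -(face_identity_target _ FN) big_pred0 // => x.
    by have := in_set0 x; rewrite -t0 inE.
  have := facefun_const (face_ind_facefun (nonroot_in_faces FN)) j0 d0 (r 0).
  by rewrite d0F (negPf (root_not_nonroot 0 FN)) => /eqP; rewrite oner_eq0.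
have par2 : 2 *+ tcount F = 0 :> 'Z_4.
  have := sum_face_perm d0 (fun d => col d); rewrite -FE.
  rewrite (eq_bigr (fun d => col d + if tdart d then 2 else 0)) => [|d dF].
    rewrite big_split /= -[RHS]addr0 => /addrI; rewrite -big_mkcondr /= => s0.
    rewrite tc -sumr_const -[RHS]s0; apply: eq_bigl => d; by rewrite inE.
  case: ifP => [td|/negbT sd]; first by rewrite col_fp_t.
  by rewrite addr0 col_fp_s // (nonroot_off_root FN).
by case: (tcount F) n0 par2 => [|[|n]].
Qed.

Lemma card_source v : #|[set d : D | source d == v]| = 4%N.
Proof. exact: reg4. Qed.

Lemma card_darts : #|{: D}| = (4 * #|V|)%N.
Proof.
rewrite mulnC -sum_nat_const -sum1_card (partition_big (@source G) xpredT) //=.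
apply: eq_bigr => v _; rewrite -(card_source v) -sum1_card.
by apply: eq_bigl => d; rewrite inE.
Qed.

Lemma card_faces : #|faces G| = (#|V| + 2)%N.
Proof.
have := euler G; have := card_darts; rewrite card_prod card_bool.
by rewrite -/(faces G); set a := #|edge G|; set b := #|V|; set c := #|_|; lia.
Qed.

Lemma card_nonroot : (#|nonroot_faces vs| + 4 = #|faces G|)%N.
Proof.
pose RF := [set face_of (r i) | i in 'Z_4].
have cRF : #|RF| = 4%N.
  rewrite card_imset ?card_ord // => i j e; apply: root_face_inj.
  by rewrite -e porbit_id.
have sub : RF \subset faces G.
  by apply/subsetP => F /imsetP [i _ ->]; apply: imset_f.
rewrite -(cardsID RF (faces G)) (setIidPr sub) cRF addnC; congr (_ + _)%N.
apply: eq_card => F; rewrite [RHS]inE; case: (boolP (F \in faces G)) => FF.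
  by rewrite nonroot_faceP // andbT.
by rewrite andbF; apply/negbTE; apply: contra FF; apply: nonroot_in_faces.
Qed.

(** Eight darts touch the root; on the others reversal exchanges the turns and the non-turns. *)
Lemma card_tdarts : (2 * \sum_(d | tdart d) 1 + 8 = #|{: D}|)%N.
Proof.
have rt : (\sum_(d | off_root d && ~~ tdart d) 1 = \sum_(d | tdart d) 1)%N.
  rewrite [RHS](reindex_inj (@rev_dart_inj E)); apply: eq_bigl => d /=.
  case: (boolP (off_root d)) => dn; first by rewrite tdart_rev.
  by apply/esym/negbTE; apply: contra dn => /tdart_off_root; rewrite off_root_rev.
have tt : (\sum_(d | off_root d && tdart d) 1 = \sum_(d | tdart d) 1)%N.
  by apply: eq_bigl => d; rewrite andb_idl // => /tdart_off_root.
have sv : (\sum_(d | source d == vs) 1 = 4)%N.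
  by rewrite -[RHS](card_source vs) -sum1_card; apply: eq_bigl => d; rewrite inE.
have tv : (\sum_(d | target d == vs) 1 = 4)%N.
  by rewrite -[RHS]sv [RHS](reindex_inj (@rev_dart_inj E)).
have -> : #|{: D}| = (\sum_(d : D) 1)%N by rewrite sum1_card.
have e1 : (\sum_(d : D) 1 = \sum_(d | off_root d) 1 + \sum_(d | ~~ off_root d) 1)%N.
  by rewrite (bigID off_root).
have e2 : (\sum_(d | off_root d) 1 = \sum_(d | off_root d && tdart d) 1 +
    \sum_(d | off_root d && ~~ tdart d) 1)%N by rewrite (bigID tdart).
have e3 : (\sum_(d | ~~ off_root d) 1 = \sum_(d | ~~ off_root d && (source d == vs)) 1 +
    \sum_(d | ~~ off_root d && (source d != vs)) 1)%N by rewrite (bigID (fun d => source d ==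
      vs)).
have e4 : (\sum_(d | ~~ off_root d && (source d == vs)) 1 = 4)%N.
  rewrite -[RHS]sv; apply: eq_bigl => d.
  by rewrite /off_root; case: (source d == vs); rewrite ?andbF.
have e5 : (\sum_(d | ~~ off_root d && (source d != vs)) 1 = 4)%N.
  rewrite -[RHS]tv; apply: eq_bigl => d.
  rewrite /off_root; case: eqP => /= [sd|]; last by rewrite andbT negbK.
  by rewrite -sd /target (negPf (source_rev_neq d)).
rewrite e1 e2 e3 tt rt e4 e5; lia.
Qed.

(* There are [2n - 4] turning darts and [n - 2] non-root faces, each of which has at
   least two of them. *)
Lemma tcount_exact F : F \in faces G -> tcount F = ((F \in nonroot_faces vs) * 2)%N.
Proof.
have total : (\sum_(F in faces G) tcount F = \sum_(d | tdart d) 1)%N.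
  rewrite [RHS](partition_big (@face_of G) (mem (faces G))) => [|d _]; last first.
    exact: imset_f.
  apply: eq_bigr => F' /imsetP [d0 _ ->]; apply: eq_bigl => d.
  by rewrite -/(face_of d0) mem_face_eq.
have s2 : (\sum_(F in faces G) ((F \in nonroot_faces vs) * 2) = \sum_(F in faces G) tcount F)%N.
  rewrite total -big_distrl /= -big_mkcondr sum1_card.
  have -> : #|[pred i in faces G | i \in nonroot_faces vs]| = #|nonroot_faces vs|.
    by apply: eq_card => F'; rewrite !inE; case: (F' \in faces G).
  have ar (T N F' v DD : nat) :
    (2 * T + 8 = DD -> DD = 4 * v -> F' = v + 2 -> N + 4 = F' -> N * 2 = T)%N by lia.
  exact: ar card_tdarts card_darts card_faces card_nonroot.
have ge F' : F' \in faces G -> ((F' \in nonroot_faces vs) * 2 <= tcount F')%N.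
  by move=> _; case: (boolP (F' \in nonroot_faces vs)) => // /tcount_ge2.
move=> FF; have : (\sum_(F in faces G) (tcount F - (F \in nonroot_faces vs) * 2) == 0)%N.
  by rewrite sumnB // s2 subnn.
rewrite sum_nat_eq0 => /forall_inP /(_ F FF); rewrite subn_eq0 => le.
by apply/eqP; rewrite eqn_leq le ge.
Qed.

Lemma tdart_nonroot d : tdart d -> face_of d \in nonroot_faces vs.
Proof.
move=> td; have FF : face_of d \in faces G by apply: imset_f.
have := tcount_exact FF; case: (face_of d \in nonroot_faces vs) => //.
by rewrite /tcount (bigD1 d) /= ?td ?porbit_id.
Qed.

(** After [d] the contour has color [col d + 2]; to recover its color it must turn again while it
    has that one. *)
Lemma nonroot_types d : tdart d -> exists t,
  [/\ tdart t, t \in face_of d, col t = col d + 2,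
      forall x, x \in face_of d -> tdart x -> x = d \/ x = t
    & forall x, x \in face_of d -> col x = col d \/ col x = col d + 2].
Proof.
move=> td; have FN := tdart_nonroot td; have Fn := nonroot_off_root FN.
have cols x : x \in face_of d -> col x = col d \/ col x = col d + 2.
  move: x; apply: face_closed; last by left.
  move=> x xF; case: (boolP (tdart x)) => [tx|sx].
    by rewrite col_fp_t //; case=> ->; rewrite ?Z4E; tauto.
  by rewrite col_fp_s // Fn.
have [t /andP [/andP [tF tt] /eqP ct]] : exists t, (t \in face_of d) && tdart t && (col t == col
  d + 2).
  apply/existsP; apply: contraT => /existsPn no.
  have : col d = col d + 2.
    have : forall x, x \in face_of (fp d) -> col x = col d + 2.
      apply: face_closed; last by rewrite col_fp_t.
      move=> x; rewrite face_of_perm => xF cx.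
      rewrite col_fp_s ?Fn //; have := no x; rewrite xF cx eqxx andbT /=.
      by [].
    by apply; rewrite face_of_perm porbit_id.
  by move/eqP; rewrite Z4_neqE.
exists t; split=> // x xF tx.
case: (eqVneq x d) => [|xd]; first by left.
case: (eqVneq x t) => [|xt]; first by right.
have := tcount_exact (nonroot_in_faces FN); rewrite FN /tcount.
rewrite (bigD1 d) ?td ?porbit_id //= (bigD1 t) /=; last first.
  rewrite tt tF; apply: contraTneq (eqxx (col d)) => td'.
  by move/eqP: ct; rewrite td' Z4_neqE.
by rewrite (bigD1 x) /= ?tx ?xF ?xd ?xt // .
Qed.

(** * Root faces and disjoint paths *)

(** The non-root faces use up all the turns. *)
Lemma root_face_s i d : d \in face_of (r i) -> ~~ tdart d.
Proof.
move=> dF; apply/negP => /tdart_nonroot FN.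
have := root_not_nonroot i FN.
by rewrite mem_face_eq eq_sym -mem_face_eq dF.
Qed.

Lemma root_face_source i d : d \in face_of (r i) -> source d = vs -> d = r i.
Proof. by move=> dF /root_dart [j dE]; subst d; rewrite (root_face_inj dF). Qed.

Lemma root_face_col i d : d \in face_of (r i) -> source d != vs -> col d = i + 1.
Proof.
move: d; apply: face_closed => [d dF IH|]; last by rewrite source_r eqxx.
rewrite source_face_perm => tn.
case: (eqVneq (source d) vs) => [/(root_face_source dF) ->|sn].
  by rewrite col_face_perm ?target_r // col_rev_r.
by rewrite col_fp_s ?IH // ?(root_face_s dF) // /off_root sn tn.
Qed.

(** Without turns, the contour after [r i] keeps the color [i + 1] until it is back at the root, so
    it is the tree path of this color; the proof telescopes along it. *)
Lemma root_face_flow_next i x :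
  path_flow (i + 1) (target (r i)) x = bd (face_of (r i)) x - arcflow (r i) x.
Proof.
pose g v := path_flow (i + 1) v x.
have tel : \sum_(d in face_of (r i)) (g (source d) - g (target d)) = 0.
  rewrite sumrB -(sum_face_perm (r i) (fun d => g (source d))).
  by apply/eqP; rewrite subr_eq0; apply/eqP; apply: eq_bigr => d _; rewrite source_face_perm.
rewrite -sum_arcflow (bigD1 (r i)) ?porbit_id //= [RHS]addrAC subrr add0r.
move: tel; rewrite (bigD1 (r i)) ?porbit_id //= source_r {1}/g path_flow_root sub0r.
rewrite addrC => /eqP; rewrite subr_eq0 /g => /eqP <-.
apply: eq_bigr => d /andP [dF dn].
have sn : source d != vs by apply: contra dn => /eqP /(root_face_source dF) ->.
rewrite /g path_flow_step // parE // -{1 3}(root_face_col dF sn) out_col // addrK.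
by [].
Qed.

(** The contour on the other side of [r i], run backwards, keeps the color [i + 3]. *)
Lemma root_face_flow_prev i x :
  path_flow (i + 3) (target (r i)) x = - bd (face_of (r (i + 3))) x - arcflow (r i) x.
Proof.
pose g v := path_flow (i + 3) v x; pose F := face_of (r (i + 3)).
have iE : r i = r (i + 3 + 1) by rewrite Z4E.
have rF : rev_dart (r i) \in F.
  by rewrite -mem_face_perm iE fp_rev_r porbit_id.
have tel : \sum_(d in F) (g (target d) - g (source d)) = 0.
  rewrite sumrB -(sum_face_perm (r (i + 3)) (fun d => g (source d))).
  by apply/eqP; rewrite subr_eq0; apply/eqP; apply: eq_bigr => d _; rewrite source_face_perm.
have arcs : \sum_(d in F | d != rev_dart (r i)) (g (target d) - g (source d)) =
  - \sum_(d in F | d != rev_dart (r i)) arcflow d x.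
  rewrite -sumrN; apply: eq_bigr => d /andP [dF dn].
  have [tv|tn] := eqVneq (target d) vs.
    have [j jE] := root_dart tv.
    case/eqP: dn; apply: (canRL (@rev_dartK G)); rewrite jE; congr r.
    have sn : source d != vs by rewrite -tv /target eq_sym source_rev_neq.
    by have := root_face_col dF sn; rewrite -[d]rev_dartK jE col_rev_r Z4E.
  have ce : col (rev_dart d) = i + 3.
    have [/(root_face_source dF) ->|sn] := eqVneq (source d) vs; first by rewrite col_rev_r.
    by rewrite sdart_col ?(root_face_s dF) /off_root ?sn // (root_face_col dF sn) Z4E.
  have oE : out (i + 3) (target d) = rev_dart d by rewrite -ce out_col.
  rewrite /g [path_flow _ (target d) x]path_flow_step // parE // oE /target rev_dartK
    arcflow_revl.
  by rewrite addrK.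
move: tel; rewrite (bigD1 (rev_dart (r i))) //= arcs.
have -> : bd F x = - arcflow (r i) x + \sum_(d in F | d != rev_dart (r i)) arcflow d x.
  by rewrite -arcflow_revl -sum_arcflow (bigD1 (rev_dart (r i))).
rewrite {1}/target rev_dartK source_r {1}/g path_flow_root /g => ?; lra.
Qed.

(** The two paths run along the two root-faces at this root-edge, so the region consists of these
    faces only and contributes 0 to the coordinate. *)
Lemma pot_root_vertex i d : pot i (target (r (i + 1))) d =
  (d \in face_of (r (i + 1)))%:R + (d \in face_of (r i))%:R.
Proof.
have FF j : face_of (r j) \in faces G by apply: imset_f.
apply: (@facefun_eq _ (fun d => (d \in face_of (r (i + 1)))%:R + (d \in face_of (r i))%:R)
  (r (i + 1)) (pot_ff _ _)).
- by move=> x; rewrite !mem_face_perm.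
- move=> x; rewrite pot_jump /cycle_flow -Z4_add11 root_face_flow_next.
  have := root_face_flow_prev (i + 1) x; rewrite Z4E => ->.
  by rewrite /bd /jump; ring.
rewrite pot_r1 porbit_id; have -> : (r (i + 1) \in face_of (r i)) = false; last by rewrite addr0.
by apply/negP => /root_face_inj /eqP; rewrite eq_sym Z4_neqE.
Qed.

Lemma par_root_vertex i v : v != vs -> par i v = vs -> v = target (r i).
Proof.
move=> vn; rewrite parE // => /root_dart [j jE].
have ij : i = j by rewrite -(col_out i vn) -[out i v]rev_dartK jE col_rev_r.
by rewrite ij -jE /target rev_dartK source_out.
Qed.

(** Along the tree of color [i + 1], away from the root, each arc adds 0 or 1 to a value that starts
    as a sum of two indicators. *)
Lemma pot_nat i v d : v != vs -> exists k : nat, pot i v d = k%:R.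
Proof.
elim/(@tree_ind (i + 1)): v => [|v vn IH _]; first by rewrite eqxx.
have [/(par_root_vertex vn) ->|pn] := eqVneq (par (i + 1) v) vs.
  by rewrite pot_root_vertex -natrD; eexists.
have [k kE] := IH pn; have [+ _] := pot_arc vn pn => /(_ d) [] ->; rewrite kE.
  by exists k.
by exists k.+1; rewrite -addn1 natrD.
Qed.

Lemma pot01 i v d : v != vs -> pot i v d = 0 \/ pot i v d = 1.
Proof.
move=> vn; have [k kE] := pot_nat i d vn; have [l lE] := pot_nat (i + 2) d vn.
move: lE; rewrite pot_compl // kE => e.
have : (k + l = 1)%N by apply/eqP; rewrite -(eqr_nat rat) natrD -e; apply/eqP; ring.
by case: k {kE e} => [|[|k]]; [left|right|].
Qed.

Lemma path_flow_on k v d : on_path k v d -> path_flow k v d = 1.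
Proof.
move=> o; rewrite /path_flow o (_ : on_path k v (rev_dart d) = false) ?subr0 //.
by apply/negP => /on_arc; apply/negP; apply: arc_anti (on_arc o).
Qed.

Lemma path_flow_opposite k w d : d \in A k -> path_flow (k + 2) w d = 0.
Proof.
move=> dA; apply: path_flow_0; apply/negP => dA'.
  by have := arc_color_uniq dA dA' => /eqP; rewrite Z4_neqE.
case: (arc_rev_col dA dA') => /eqP; last by rewrite -Z4_add21 Z4_neqE.
by rewrite -Z4_add11 eq_sym Z4_neqE.
Qed.

Lemma cycle_flow_on2 i v d : on_path (i + 2) v d -> cycle_flow i v d = 1.
Proof.
move=> o; rewrite /cycle_flow path_flow_on // -[i in path_flow i]Z4_add22 path_flow_opposite
  ?subr0 //.
exact: on_arc o.
Qed.

Lemma cycle_flow_on0 i v d : on_path i v d -> cycle_flow i v d = -1.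
Proof. by move=> o; rewrite /cycle_flow (path_flow_on o) path_flow_opposite ?sub0r // (on_arc o).
  Qed.

Lemma cycle_flow_rev i v d : cycle_flow i v (rev_dart d) = - cycle_flow i v d.
Proof. by case: (cycle_flow_circ i v) => ->. Qed.

Lemma connect_in k v w : connect (arc_rel (A k)) v w -> v != w ->
  exists z, [/\ z != vs, on_path k v (out k z) & par k z = w].
Proof.
case/connectP; elim/last_ind => [|p u _] /=; first by move=> _ ->; rewrite eqxx.
rewrite rcons_path last_rcons => /andP [pp /par_arc [zn zp]] -> _.
exists (last v p); split=> //; rewrite /on_path source_out //.
by case: (outP k zn) => -> _; apply/connectP; exists p.
Qed.

Lemma on_connect k v w : w != vs -> on_path k v (out k w) = connect (arc_rel (A k)) v w.
Proof. by move=> wn; rewrite /on_path source_out //; case: (outP k wn) => ->. Qed.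

Lemma pot_out_next i k v w : w != vs ->
  pot i v (out (k + 1) w) = pot i v (out k w) - cycle_flow i v (out k w).
Proof. by move=> wn; rewrite -pot_rev -(facefun_ccwV _ (pot_ff i v)) cw_out. Qed.

(* Around a common vertex [w <> v] of [P_i(v)] and [P_(i+2)(v)] the potential
   [pot i v] would take three values. *)
Lemma paths_disjoint i v w : v != vs -> w != vs -> on_path i v (out i w) ->
  on_path (i + 2) v (out (i + 2) w) -> w = v.
Proof.
move=> vn wn o0 o2; apply/eqP; apply: contraT; rewrite eq_sym => vw.
move: (o2); rewrite on_connect // => /connect_in /(_ vw) [z [zn oz pz]].
pose g := rev_dart (out (i + 2) z).
have sg : source g = w by rewrite -pz parE.
have zn' : source (out (i + 2) z) != vs by rewrite source_out.
have tn' : target (out (i + 2) z) != vs by rewrite -parE // pz.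
have gp : cycle_flow i v g = -1 by rewrite cycle_flow_rev cycle_flow_on2.
have gn : source g != vs by rewrite sg.
have := out_col gn; rewrite sg => gE.
have e0 := pot_out_next i i v wn; rewrite cycle_flow_on0 // in e0.
have e1 := pot_out_next i (i + 1) v wn; rewrite Z4E in e1.
have e2 := pot_out_next i (i + 2) v wn; rewrite cycle_flow_on2 // Z4E in e2.
have e3 := pot_out_next i (i + 3) v wn; rewrite Z4E in e3.
have h k := pot01 i (out k w) vn.
(* [g] is next to [out i w] in the rotation, and crossing both clockwise raises the potential by
   2. *)
have := col_rev zn' tn'; rewrite col_out // -/g => -[]; rewrite Z4E => cg;
  move: gE gp; rewrite cg => <- gp; rewrite gp in e1 e3 *; have := h i; have := h (i + 1);
  have := h (i + 2); have := h (i + 3); lra.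
Qed.

(** * Regions and coordinates *)

Lemma tree_pathE i v d : (d.1 \in tree_path A i v) = on_path i v d || on_path i v (rev_dart d).
Proof. by rewrite tree_edgesP !inE. Qed.

Definition cycle_edges i v : {set E} := tree_path A i v :|: tree_path A (i + 2%:R) v.

Lemma cycle_edgesE i v d : (d.1 \in cycle_edges i v) =
  [|| on_path i v d, on_path i v (rev_dart d), on_path (i + 2) v d | on_path (i + 2) v (rev_dart
    d)].
Proof. by rewrite in_setU !tree_pathE -orbA. Qed.

Lemma cycle_flow_off i v d : d.1 \notin cycle_edges i v -> cycle_flow i v d = 0.
Proof.
rewrite cycle_edgesE !negb_or => /and4P [/negPf a /negPf b /negPf c /negPf e].
by rewrite /cycle_flow /path_flow a b c e subrr.
Qed.

Lemma dual_step (C : {set E}) d : d.1 \notin C -> connect (dual_adj C) (face_of d) (face_of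
  (rev_dart d)).
Proof. by move=> dC; apply/connect1/existsP; exists d; rewrite dC !eqxx. Qed.

Lemma region_sub i v d : v != vs ->
  connect (dual_adj (cycle_edges i v)) (face_of (r (i + 1))) (face_of d) -> pot i v d = 1.
Proof.
move=> vn /connectP [p].
have H0 : forall x, x \in face_of (r (i + 1)) -> pot i v x = 1.
  by move=> x /(facefun_face (pot_ff i v)) ->; rewrite pot_r1.
elim: p (face_of (r (i + 1))) H0 => [|F' p IH] F HF /=.
  by move=> _ dF; apply: HF; rewrite -dF porbit_id.
case/andP=> /existsP [x /and3P [xC /eqP FE /eqP F'E]] pp lp; apply: (IH F') => // y.
rewrite F'E => /(facefun_face (pot_ff i v)) ->.
by rewrite pot_rev cycle_flow_off // subr0 HF // FE porbit_id.
Qed.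

(** Conservation propagates the value 0 from [v] along each path: by disjointness, a vertex of a
    path other than [v] and the root meets no edge of the other one. *)
Lemma cycle_circulation0 i v chi : v != vs -> circulation chi ->
  (forall d, d.1 \notin cycle_edges i v -> chi d = 0) ->
  chi (out (i + 2) v) = 0 -> forall d, chi d = 0.
Proof.
move=> vn [anti div] off c2.
have key k k' : (forall d, d.1 \in cycle_edges i v ->
      [|| on_path k v d, on_path k v (rev_dart d), on_path k' v d | on_path k' v (rev_dart d)]) ->
    (forall w, w != vs -> on_path k v (out k w) -> on_path k' v (out k' w) -> w = v) ->
    chi (out k v) = 0 \/ chi (out k' v) = 0 ->
    forall w, w != vs -> on_path k v (out k w) -> chi (out k w) = 0.
  move=> cE disj c0 w; have [n] := ubnP (dep k v - dep k w)%N.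
  elim: n w => // n IH w ltn wn ow.
  (* Both paths leave from [v], so there one of the two values has to be known beforehand. *)
  have [[wv c0v]|cw] : (w = v /\ chi (out k v) = 0) \/ (w = v -> chi (out k' v) = 0).
    by case: (eqVneq w v) => [wv|/eqP wv]; [case: c0 => c0; [left|right]|right].
  - by rewrite wv.
  rewrite -[RHS](div w) (bigD1 (out k w)) /=; last by rewrite source_out.
  rewrite big1 ?addr0 // => d /andP [/eqP sd dn].
  have [dC|] := boolP (d.1 \in cycle_edges i v); last exact: off.
  case/or4P: (cE _ dC) => [od|od|od|od].
  - by case/eqP: dn; rewrite (arc_out (on_arc od)) sd.
  - have rdn := arc_source (on_arc od); have rdE := arc_out (on_arc od).
    have pw : par k (source (rev_dart d)) = w.
      by rewrite parE // -rdE /target rev_dartK.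
    rewrite -[d]rev_dartK anti rdE IH ?oppr0 //; last by rewrite -rdE.
    have := dep_par k rdn; rewrite pw => dE; have := connect_dep (proj2 (andP od)).
    case/orP=> [|/eqP vE]; first by lia.
    by move: ltn; rewrite vE dE; lia.
  - have dE : d = out k' w by rewrite (arc_out (on_arc od)) sd.
    have wv : w = v by apply: disj => //; rewrite -dE.
    by rewrite dE wv cw.
  - have rdn := arc_source (on_arc od); have rdE := arc_out (on_arc od).
    have pw : par k' (source (rev_dart d)) = w.
      by rewrite parE // -rdE /target rev_dartK.
    have cz := proj2 (andP od).
    have ow' : on_path k' v (out k' w).
      rewrite on_connect //; apply: connect_trans cz _.
      by rewrite -pw; apply/connect1/arc_par.
    have wv := disj _ wn ow ow'.
    have := dep_par k' rdn; rewrite pw wv => dE.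
    have := connect_dep cz; rewrite dE ltnNge leqnSn /= => /eqP vE.
    by move: dE; rewrite -vE => /n_Sn.
have d2 w : w != vs -> on_path i v (out i w) -> on_path (i + 2) v (out (i + 2) w) -> w = v.
  by move=> wn; apply: paths_disjoint.
have k2 : forall w, w != vs -> on_path (i + 2) v (out (i + 2) w) -> chi (out (i + 2) w) = 0.
  apply: (key _ i) => [d|w wn o2 o0|]; [|by apply: d2|by left].
  rewrite cycle_edgesE => /or4P [] ->; by rewrite ?orbT.
have k0 : forall w, w != vs -> on_path i v (out i w) -> chi (out i w) = 0.
  by apply: (key _ (i + 2)) => [d|//|]; [rewrite cycle_edgesE|right].
have on0 k d : (forall w, w != vs -> on_path k v (out k w) -> chi (out k w) = 0) ->
    on_path k v d -> chi d = 0.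
  move=> kk od; have dE := arc_out (on_arc od).
  by rewrite dE kk -?dE // (arc_source (on_arc od)).
move=> d; have [|] := boolP (d.1 \in cycle_edges i v); last exact: off.
rewrite cycle_edgesE => /or4P [] od; [|rewrite -[d]rev_dartK anti| |rewrite -[d]rev_dartK anti].
- exact: on0 k0 od.
- by rewrite (on0 _ _ k0 od) oppr0.
- exact: on0 k2 od.
- by rewrite (on0 _ _ k2 od) oppr0.
Qed.

(** The indicator of the dual component jumps only on the cycle, so its jump is a multiple of the
    cycle flow; the values at [r (i + 1)] and [r (i + 2)] then identify it with the potential. *)
Lemma region_pot i v d : v != vs -> (face_of d \in region r A i v) = (pot i v d == 1).
Proof.
move=> vn; rewrite inE imset_f //= -/(cycle_edges i v).
pose C := cycle_edges i v; pose F1 := face_of (r (i + 1)).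
rewrite -/C -/F1.
pose gam d : rat := (connect (dual_adj C) F1 (face_of d))%:R.
have gg : facefun gam by move=> x; rewrite /gam face_of_perm.
have jg x : x.1 \notin C -> jump gam x = 0.
  move=> xC; have xC' : (rev_dart x).1 \notin C by [].
  have c1 := dual_step xC; have c2 := dual_step xC'; rewrite rev_dartK in c2.
  rewrite /jump /gam; suff -> : connect (dual_adj C) F1 (face_of x) =
    connect (dual_adj C) F1 (face_of (rev_dart x)) by rewrite subrr.
  by apply/idP/idP => c; apply: connect_trans c _.
pose kap := jump gam (out (i + 2) v).
pose chi d := jump gam d - kap * cycle_flow i v d.
have cc : circulation chi.
  have [a1 s1] := jump_circ gg; have [a2 s2] := cycle_flow_circ i v.
  split=> [x|w]; first by rewrite /chi a1 a2; ring.
  by rewrite /chi sumrB -mulr_sumr s1 s2 mulr0 subrr.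
have chi0 : forall x, chi x = 0.
  apply: (cycle_circulation0 (i := i) vn cc) => [x xC|].
    by rewrite /chi (jg x xC) (cycle_flow_off xC) mulr0 subrr.
  by rewrite /chi cycle_flow_on2 ?on_out // mulr1 subrr.
have aff x y : gam x - kap * pot i v x = gam y - kap * pot i v y.
  apply: (@facefun_const _ (fun x => gam x - kap * pot i v x)) => [z|z].
    by rewrite gg pot_ff.
  by rewrite -[RHS](chi0 z) /chi -pot_jump /jump; ring.
have g1 : gam (r (i + 1)) = 1 by rewrite /gam connect0.
have g2 : gam (r (i + 2)) = 0.
  rewrite /gam; case: (boolP (connect _ _ _)) => // /(region_sub vn).
  by rewrite pot_r2 // => /eqP; rewrite eq_sym oner_eq0.
have gE : gam d = pot i v d.
  have := aff d (r (i + 2)); have := aff (r (i + 1)) (r (i + 2)).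
  by rewrite g1 g2 pot_r1 pot_r2 // mulr1 mulr0 subrr => /eqP; rewrite subr_eq0 => /eqP <-; lra.
by rewrite -gE /gam; case: (connect _ _ _); rewrite ?eqxx // eq_sym oner_eq0.
Qed.

Definition zone i v : {set {set D}} := region r A i v :&: nonroot_faces vs.
(** [crd 1] and [crd 0] are the abscissa and the ordinate, [crd 3] and [crd 2] their complements to
    [n - 2], so that one statement serves all four colors. The lock prevents unfolding. *)
Definition crd i v : nat := locked #|zone i v|.
Arguments crd i%_R v.

Lemma zoneE i v d : v != vs -> (face_of d \in zone i v) =
  (pot i v d == 1) && (face_of d \in nonroot_faces vs).
Proof. by move=> vn; rewrite in_setI region_pot. Qed.

Lemma zone_face i v F : F \in zone i v -> exists2 d, F = face_of d & F \in nonroot_faces vs.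
Proof. by rewrite in_setI => /andP [_ FN]; have [d dF] := nonroot_nonempty FN; exists d => //;
  apply: nonroot_face. Qed.

Lemma crd_compl i v : v != vs -> (crd i v + crd (i + 2)%R v = #|V| - 2)%N.
Proof.
move=> vn; have -> : (#|V| - 2 = #|nonroot_faces vs|)%N.
  have ar (a b c : nat) : (a + 4 = b -> b = c + 2 -> c - 2 = a)%N by lia.
  exact: ar card_nonroot card_faces.
rewrite -(cardsID (zone i v)) /crd -!lock; congr (_ + _)%N; apply: eq_card => F.
  by rewrite [RHS]in_setI andb_idl // => /zone_face [].
rewrite in_setD; have [FN|FN] := boolP (F \in nonroot_faces vs); last first.
  by rewrite andbF; apply: contraNF FN => /zone_face [].
have [d dF] := nonroot_nonempty FN; have FE := nonroot_face FN dF.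
rewrite andbT FE !zoneE // -FE FN !andbT pot_compl //.
by case: (pot01 i d vn) => ->; rewrite ?subr0 ?subrr ?eqxx // eq_sym oner_eq0.
Qed.

Lemma crd_bound i v : v != vs -> (crd i v <= #|V| - 2)%N.
Proof. by move=> vn; rewrite -(crd_compl i vn) leq_addr. Qed.

Lemma nonroot_of_pot i v w d : v != vs -> w != vs -> pot i v d != pot i w d ->
  face_of d \in nonroot_faces vs.
Proof.
move=> vn wn; have FF : face_of d \in faces G by apply: imset_f.
rewrite nonroot_faceP //; apply: contra => /imsetP [j _ FE].
have dF : d \in face_of (r j) by rewrite -FE porbit_id.
by rewrite !(facefun_face (pot_ff i _) dF) (pot_roots i j vn wn).
Qed.

(** For functions with values 0 and 1, [pot_arc] means strict inclusion of regions; a face in the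
    difference is non-root because all potentials agree on root-faces. *)
Lemma crd_arc i d : off_root d -> col d = i + 1 -> (crd i (target d) < crd i (source d))%N.
Proof.
case/andP=> sn tn cd.
have pE : par (i + 1) (source d) = target d by rewrite parE // -cd out_col.
have := @pot_arc i (source d) sn; rewrite pE => /(_ tn) [mono [x0 xE]].
have le2 x : pot i (source d) x = pot i (target d) x + 1 -> pot i (target d) x = 0.
  by case: (pot01 i x sn) => ->; case: (pot01 i x tn) => -> //; lra.
rewrite /crd -!lock; apply: proper_card; apply/properP; split.
  apply/subsetP => F Fz; have [x FE FN] := zone_face Fz; move: Fz; rewrite FE !zoneE //.
  case/andP => /eqP Hx ->; rewrite andbT; case: (mono x); first by rewrite Hx => ->.
  by move=> e; have := le2 _ e; rewrite Hx => /eqP; rewrite oner_eq0.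
have h0 := le2 _ xE; rewrite h0 add0r in xE.
exists (face_of x0); rewrite zoneE //; last by rewrite h0 eq_sym oner_eq0.
by rewrite xE eqxx (nonroot_of_pot (i := i) sn tn) // xE h0 oner_neq0.
Qed.

Lemma crd_arc3 i d : off_root d -> col d = i + 3 -> (crd i (source d) < crd i (target d))%N.
Proof.
move=> dn cd; case/andP: (dn) => sn tn.
have := crd_arc (i := i + 2) dn; rewrite Z4E cd => /(_ erefl).
have := crd_compl i sn; have := crd_compl i tn; lia.
Qed.

Lemma crd_root_vertex i : crd i (target (r (i + 1))) = 0%N.
Proof.
rewrite /crd -lock; apply/eqP; rewrite cards_eq0; apply/eqP/setP => F; rewrite in_set0;
  apply/negP => Fz.
have [d FE FN] := zone_face Fz; move: Fz; rewrite FE zoneE ?target_r // pot_root_vertex -FE FN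
  andbT.
have nd j : (d \in face_of (r j)) = false.
  apply/negP => dF; have /negP := root_not_nonroot j FN; apply.
  by rewrite FE mem_face_eq eq_sym -mem_face_eq.
by rewrite !nd addr0 eq_sym oner_eq0.
Qed.

Lemma crd_succ i v w (F : {set D}) : v != vs -> w != vs -> F \in nonroot_faces vs ->
  (forall x, cycle_flow i v x - cycle_flow i w x = bd F x) -> crd i v = (crd i w).+1.
Proof.
move=> vn wn FN pE.
have hE x : pot i v x = pot i w x + (x \in F)%:R.
  move: x; apply: (@facefun_eq _ (fun x => pot i w x + (x \in F)%:R) (r (i + 1)) (pot_ff _ _)).
  - by move=> x; rewrite pot_ff (face_ind_facefun (nonroot_in_faces FN)).
  - move=> x; have := pE x; rewrite pot_jump /bd -(pot_jump i w) /jump => ?; lra.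
  by rewrite !pot_r1 (negPf (root_not_nonroot _ FN)) addr0.
have [d dF] := nonroot_nonempty FN; have FE := nonroot_face FN dF.
have zE : zone i v = F |: zone i w.
  apply/setP => F'; rewrite in_setU1; case: (boolP (F' \in nonroot_faces vs)) => F'N; last first.
    rewrite !in_setI (negPf F'N) !andbF orbF; apply/esym/negbTE.
    by apply: contra F'N => /eqP ->.
  have [x xF'] := nonroot_nonempty F'N; have F'E := nonroot_face F'N xF'.
  rewrite F'E in F'N *; rewrite !zoneE // F'N !andbT hE.
  have -> : (face_of x == F) = (x \in F) by rewrite FE mem_face_eq.
  case: (boolP (x \in F)) => [xF|_]; last by rewrite addr0.
  have := hE x; rewrite xF; case: (pot01 i x vn) => ->; case: (pot01 i x wn) => -> e; 
    rewrite ?add0r ?eqxx //; lra.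
rewrite /crd -!lock zE cardsU1 FE zoneE //.
have := hE d; rewrite dF; case: (pot01 i d vn) => ->; case: (pot01 i d wn) => -> e; 
  rewrite ?add1n ?[0 == 1]eq_sym ?oner_eq0 //=; lra.
Qed.

(** * The shape of a face *)

Definition fpair (F : {set D}) t1 t2 :=
  [/\ F \in nonroot_faces vs, [/\ t1 \in F, t2 \in F, tdart t1 & tdart t2],
      col t2 = col t1 + 2 & forall x, x \in F -> tdart x -> x = t1 \/ x = t2].

Lemma fpair_sym F t1 t2 : fpair F t1 t2 -> fpair F t2 t1.
Proof.
case=> FN [t1F t2F td1 td2] c2 only; split=> //; first by rewrite c2 Z4E.
by move=> x xF tx; case: (only _ xF tx); tauto.
Qed.

(** The turns have opposite colors; calling [t1] the one of color 1 or 2 leaves two types of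
    faces. *)
Lemma fpair_exists F : F \in nonroot_faces vs -> exists t1 t2,
  [/\ fpair F t1 t2, col t1 = 1 \/ col t1 = 2 &
     forall x, x \in F -> col x = col t1 \/ col x = col t2].
Proof.
move=> FN.
have [d dF td] : exists2 d, d \in F & tdart d.
  have := tcount_ge2 FN; rewrite /tcount.
  have [d /andP [td dF]|no] := pickP (fun d => tdart d && (d \in F)); first by exists d.
  by rewrite big_pred0.
have FE := nonroot_face FN dF; have [t [tt tF ct only cols]] := nonroot_types td.
have fp1 : fpair F d t by rewrite FE in FN *; split=> //; rewrite porbit_id.
rewrite -FE -ct in cols.
have [cd|cd] : (col d = 1 \/ col d = 2) \/ (col t = 1 \/ col t = 2).
  rewrite ct; case: (Z4_cases 1 (col d)) => ->; [left; left|left; right|right; left|right; right];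
  exact: val_inj.
- by exists d, t; split.
- exists t, d; split=> //; first exact: fpair_sym.
  by move=> x /cols; tauto.
Qed.

(** The reverse of [d] has color [col d + 3], which gives the first inequality; the color of [d]
    itself gives the second. At a turn the reverse has color [col d + 1], which flips the first
    one. *)
Lemma sdart_dec d : off_root d -> ~~ tdart d ->
  (crd (col d) (target d) < crd (col d) (source d))%N /\
  (crd (col d + 3)%R (target d) < crd (col d + 3)%R (source d))%N.
Proof.
move=> dn sd; split; last by apply: crd_arc; rewrite ?Z4E.
have := @crd_arc3 (col d) (rev_dart d); rewrite off_root_rev dn sdart_col // => /(_ isT erefl).
by rewrite /target rev_dartK.
Qed.

Lemma tdart_dec d : tdart d ->
  (crd (col d) (source d) < crd (col d) (target d))%N /\
  (crd (col d + 3)%R (target d) < crd (col d + 3)%R (source d))%N.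
Proof.
move=> td; have dn := tdart_off_root td; split; last by apply: crd_arc; rewrite ?Z4E.
have := @crd_arc (col d) (rev_dart d); rewrite off_root_rev dn tdart_col // => /(_ isT erefl).
by rewrite /target rev_dartK.
Qed.

Lemma fpair_neq F t1 t2 : fpair F t1 t2 -> t2 != t1.
Proof. by case=> _ _ c _; apply/eqP => e; move/eqP: c; rewrite e Z4_neqE. Qed.

Lemma fpair_sum F t1 t2 (g : D -> rat) : fpair F t1 t2 ->
  \sum_(x in F | tdart x) g x = g t1 + g t2.
Proof.
move=> fpr; have ne := fpair_neq fpr; case: fpr => FN [t1F t2F td1 td2] _ only.
rewrite (bigD1 t1) ?t1F //= (bigD1 t2) ?t2F ?td2 //= big1 ?addr0 //.
by move=> x /andP [/andP [/andP [xF tx] /eqP n1] /eqP n2]; case: (only _ xF tx).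
Qed.

Lemma cycle_flow_add2 i v x : cycle_flow (i + 2) v x = - cycle_flow i v x.
Proof. by rewrite /cycle_flow Z4E; ring. Qed.

(** The two turns contribute opposite cycle flows to the face identity, so their regions differ by
    [F] alone. This is the unit gap between the chains. *)
Lemma fpair_source F t1 t2 : fpair F t1 t2 ->
  crd (col t1 + 3) (source t1) = (crd (col t1 + 3) (source t2)).+1.
Proof.
move=> fpr; case: (fpr) => FN [t1F t2F td1 td2] c2 _.
have /andP [s1 _] := tdart_off_root td1; have /andP [s2 _] := tdart_off_root td2.
apply: (crd_succ s1 s2 FN) => x.
by rewrite -(face_identity_source _ FN) (fpair_sum _ fpr) c2 [col t1 + 2 + 3]addrAC
  cycle_flow_add2.
Qed.

Lemma fpair_target F t1 t2 : fpair F t1 t2 ->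
  crd (col t1) (target t1) = (crd (col t1) (target t2)).+1.
Proof.
move=> fpr; case: (fpr) => FN [t1F t2F td1 td2] c2 _.
have /andP [_ s1] := tdart_off_root td1; have /andP [_ s2] := tdart_off_root td2.
apply: (crd_succ s1 s2 FN) => x.
by rewrite -(face_identity_target _ FN) (fpair_sum _ fpr) c2 cycle_flow_add2.
Qed.

Lemma mem_fp F x : F \in nonroot_faces vs -> (fp x \in F) = (x \in F).
Proof. by rewrite inE => /andP [/imsetP [d0 _ ->] _]; apply: mem_face_perm. Qed.

(** The darts of color [col t1] form a chain from [target t2] to the turn [t1]; [crd c] decreases at
    each of them before [t1], so it suffices to walk forward. *)
Lemma fpair_lower F t1 t2 c x : fpair F t1 t2 -> c = col t1 \/ c = col t1 + 3 ->
  x \in F -> col x = col t1 ->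
  (crd c (source t1) <= crd c (source x) ?= iff (x == t1))%N.
Proof.
move=> fpr cc; case: (fpr) => FN [t1F t2F td1 td2] c2 only.
have [n] := ubnP (crd c (source x)); elim: n x => [|n IH] x; first by rewrite ltn0.
move=> ltn xF cx.
case: (boolP (tdart x)) => [tx|sx].
  case: (only _ xF tx) => xE; first by rewrite xE eqxx; split; rewrite ?eqxx.
  by move/eqP: cx; rewrite xE c2 eq_sym Z4_neqE.
have xn := nonroot_off_root FN xF.
have lt : (crd c (source (fp x)) < crd c (source x))%N.
  have [d1 d2] := sdart_dec xn sx; rewrite cx in d1 d2.
  by rewrite source_face_perm; case: cc => ->.
have fxF : fp x \in F by rewrite mem_fp.
have cfx : col (fp x) = col t1 by rewrite col_fp_s.
have [le _] := IH _ (leq_trans lt ltn) fxF cfx.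
have lt2 := leq_ltn_trans le lt.
split; first exact: ltnW.
rewrite ltn_eqF //; apply/esym/negbTE/eqP => e; by rewrite -e ltnn in lt2.
Qed.

(** The same chain walked backward to its beginning. *)
Lemma fpair_upper F t1 t2 c x : fpair F t1 t2 -> c = col t1 \/ c = col t1 + 3 ->
  x \in F -> col x = col t1 ->
  (crd c (source x) <= crd c (target t2) ?= iff (source x == target t2))%N.
Proof.
move=> fpr cc; case: (fpr) => FN [t1F t2F td1 td2] c2 only.
have [n] := ubnP (#|V| - 2 - crd c (source x))%N; elim: n x => [|n IH] x; first by rewrite ltn0.
move=> ltn xF cx.
pose y := fp^-1%g x; have xE : x = fp y by rewrite permKV.
have yF : y \in F by rewrite -mem_fp // -xE.
have yn := nonroot_off_root FN yF.
have sx : source x = target y by rewrite xE source_face_perm.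
case: (boolP (tdart y)) => [ty|sy].
  case: (only _ yF ty) => yE.
    by move: cx; rewrite xE col_fp_t // yE => /eqP; rewrite eq_sym Z4_neqE.
  by rewrite sx yE; split; rewrite ?eqxx.
have cy : col y = col t1 by rewrite -cx xE col_fp_s.
have lt : (crd c (source x) < crd c (source y))%N.
  have [d1 d2] := sdart_dec yn sy; rewrite cy in d1 d2.
  by rewrite sx; case: cc => ->.
have /andP [sn _] := yn; have bnd := crd_bound c sn.
have ltn' : (#|V| - 2 - crd c (source y) < n)%N.
  by move: lt ltn bnd; move: (crd c _) (crd c _) (#|V| - 2)%N => p q m; clear; lia.
have [le _] := IH _ ltn' yF cy.
have lt2 := leq_trans lt le.
split; first exact: ltnW.
rewrite ltn_eqF //; apply/esym/negbTE/eqP => e; by rewrite e ltnn in lt2.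
Qed.

(** Origin and color determine a dart, so each turn is followed on the contour by the other. *)
Lemma fpair_digon F t1 t2 : fpair F t1 t2 -> source t1 = target t2 ->
  target t1 = source t2 -> bound_digon t1.1 t2.1.
Proof.
move=> fpr st ts; have ne := fpair_neq fpr; case: (fpr) => FN [t1F t2F td1 td2] c2 _.
have f1 : fp t1 = t2.
  apply: col_inj; rewrite ?source_face_perm ?col_fp_t ?c2 //.
  by case/andP: (tdart_off_root td1).
have f2 : fp t2 = t1.
  apply: col_inj; rewrite ?source_face_perm ?col_fp_t ?c2 ?Z4E //.
  by case/andP: (tdart_off_root td2).
have FE : face_of t1 = [set t1; t2].
  apply/eqP; rewrite eqEsubset; apply/andP; split; apply/subsetP => x; last first.
    by rewrite !inE => /orP [] /eqP ->; rewrite ?porbit_id // -f1 mem_face_perm porbit_id.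
  move: x; apply: face_closed; last by rewrite !inE eqxx.
  by move=> x _; rewrite !inE => /orP [] /eqP ->; rewrite ?f1 ?f2 eqxx ?orbT.
apply/existsP; exists t1; apply/exists_inP; exists t2; rewrite FE ?set22 //.
by rewrite cards2 [t1 == t2]eq_sym ne !eqxx.
Qed.


(** * Directions of the darts by color *)

Definition xc v : nat := crd 1 v.
Definition yc v : nat := crd 0 v.

Definition cuts (t : nat) d : bool := [&& off_root d, (yc (target d) < t)%N & (t <= yc (source
  d))%N].

Lemma cuts_off_root t d : cuts t d -> off_root d.
Proof. by case/and3P. Qed.

Lemma cuts_lt t d : cuts t d -> (yc (target d) < yc (source d))%N.
Proof. by case/and3P => _; apply: leq_trans. Qed.

Lemma opp2 : 2 = 0 + 2 :> 'Z_4. Proof. exact: val_inj. Qed.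
Lemma opp3 : 3 = 1 + 2 :> 'Z_4. Proof. exact: val_inj. Qed.

Lemma crd_opp_lt (i j : 'Z_4) v w : j = i + 2 -> v != vs -> w != vs ->
  (crd j v < crd j w)%N -> (crd i w < crd i v)%N.
Proof.
move=> -> vn wn; move: (crd_compl i vn) (crd_compl i wn).
move: (crd _ v) (crd _ v) (crd _ w) (crd _ w) (#|V| - 2)%N => a b c e m; clear; lia.
Qed.

Lemma crd_opp_leqif (i j : 'Z_4) v w b : j = i + 2 -> v != vs -> w != vs ->
  (crd j v <= crd j w ?= iff b)%N -> (crd i w <= crd i v ?= iff b)%N.
Proof.
move=> -> vn wn; move: (crd_compl i vn) (crd_compl i wn).
move: (crd _ v) (crd _ v) (crd _ w) (crd _ w) (#|V| - 2)%N => p q m n k; clear.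
move=> e1 e2 [le eqb]; split; first by lia.
rewrite -eqb; apply/eqP/eqP; lia.
Qed.

Lemma crd_opp_succ (i j : 'Z_4) v w : j = i + 2 -> v != vs -> w != vs ->
  crd j v = (crd j w).+1 -> crd i w = (crd i v).+1.
Proof.
move=> -> vn wn; move: (crd_compl i vn) (crd_compl i wn).
move: (crd _ v) (crd _ v) (crd _ w) (crd _ w) (#|V| - 2)%N => a b c e m; clear; lia.
Qed.

Lemma sdart1_dir d : off_root d -> ~~ tdart d -> col d = 1 ->
  (xc (target d) < xc (source d))%N /\ (yc (target d) < yc (source d))%N.
Proof.
move=> dn sd cd; have [l1 l2] := sdart_dec dn sd; case/andP: dn => sn tn.
rewrite cd in l1 l2; rewrite (_ : 1 + 3 = 0 :> 'Z_4) in l2; last exact: val_inj.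
by split; [exact: l1|exact: l2].
Qed.

Lemma tdart1_dir d : tdart d -> col d = 1 ->
  (xc (source d) < xc (target d))%N /\ (yc (target d) < yc (source d))%N.
Proof.
move=> td cd; have [l1 l2] := tdart_dec td; case/andP: (tdart_off_root td) => sn tn.
rewrite cd in l1 l2; rewrite (_ : 1 + 3 = 0 :> 'Z_4) in l2; last exact: val_inj.
by split; [exact: l1|exact: l2].
Qed.

Lemma sdart2_dir d : off_root d -> ~~ tdart d -> col d = 2 ->
  (yc (source d) < yc (target d))%N /\ (xc (target d) < xc (source d))%N.
Proof.
move=> dn sd cd; have [l1 l2] := sdart_dec dn sd; case/andP: dn => sn tn.
rewrite cd in l1 l2; rewrite (_ : 2 + 3 = 1 :> 'Z_4) in l2; last exact: val_inj.
by split; [exact: (crd_opp_lt opp2 _ _ l1)|exact: l2].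
Qed.

Lemma tdart2_dir d : tdart d -> col d = 2 ->
  (yc (target d) < yc (source d))%N /\ (xc (target d) < xc (source d))%N.
Proof.
move=> td cd; have [l1 l2] := tdart_dec td; case/andP: (tdart_off_root td) => sn tn.
rewrite cd in l1 l2; rewrite (_ : 2 + 3 = 1 :> 'Z_4) in l2; last exact: val_inj.
by split; [exact: (crd_opp_lt opp2 _ _ l1)|exact: l2].
Qed.

Lemma sdart3_dir d : off_root d -> ~~ tdart d -> col d = 3 ->
  (xc (source d) < xc (target d))%N /\ (yc (source d) < yc (target d))%N.
Proof.
move=> dn sd cd; have [l1 l2] := sdart_dec dn sd; case/andP: dn => sn tn.
rewrite cd in l1 l2; rewrite (_ : 3 + 3 = 2 :> 'Z_4) in l2; last exact: val_inj.
by split; [exact: (crd_opp_lt opp3 _ _ l1)|exact: (crd_opp_lt opp2 _ _ l2)].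
Qed.

Lemma tdart3_dir d : tdart d -> col d = 3 ->
  (xc (target d) < xc (source d))%N /\ (yc (source d) < yc (target d))%N.
Proof.
move=> td cd; have [l1 l2] := tdart_dec td; case/andP: (tdart_off_root td) => sn tn.
rewrite cd in l1 l2; rewrite (_ : 3 + 3 = 2 :> 'Z_4) in l2; last exact: val_inj.
by split; [exact: (crd_opp_lt opp3 _ _ l1)|exact: (crd_opp_lt opp2 _ _ l2)].
Qed.

Lemma sdart0_dir d : off_root d -> ~~ tdart d -> col d = 0 ->
  (yc (target d) < yc (source d))%N /\ (xc (source d) < xc (target d))%N.
Proof.
move=> dn sd cd; have [l1 l2] := sdart_dec dn sd; case/andP: dn => sn tn.
rewrite cd in l1 l2; rewrite (_ : 0 + 3 = 3 :> 'Z_4) in l2; last exact: val_inj.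
by split; [exact: l1|exact: (crd_opp_lt opp3 _ _ l2)].
Qed.

Lemma tdart0_dir d : tdart d -> col d = 0 ->
  (yc (source d) < yc (target d))%N /\ (xc (source d) < xc (target d))%N.
Proof.
move=> td cd; have [l1 l2] := tdart_dec td; case/andP: (tdart_off_root td) => sn tn.
rewrite cd in l1 l2; rewrite (_ : 0 + 3 = 3 :> 'Z_4) in l2; last exact: val_inj.
by split; [exact: l1|exact: (crd_opp_lt opp3 _ _ l2)].
Qed.

(* The two segments are compared at the heights in [t - 1, t]; in the last two cases
   neither chain of the face crosses this strip, and both segments join the two chains. *)
Definition compared t d u : Prop :=
  [/\ (xc (source d) <= xc (target u) ?= iff (source d == target u))%N,
      (xc (target d) <= xc (source u) ?= iff (target d == source u))%N &
   [\/ (xc (target d) < xc (source d))%N /\ (xc (target u) < xc (source u))%N,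
       (xc (source d) < xc (target d))%N /\ (xc (source u) < xc (target u))%N,
       [/\ yc (source d) = t, (yc (source u)).+1 = t,
           (xc (source d) < xc (target d))%N /\ (xc (target u) < xc (source u))%N,
           tdart d /\ tdart u
         & source d = target u -> target d = source u -> bound_digon d.1 u.1]
     | [/\ (yc (target d)).+1 = t, yc (target u) = t,
           (xc (target d) < xc (source d))%N /\ (xc (source u) < xc (target u))%N,
           tdart d /\ tdart u
         & source d = target u -> target d = source u -> bound_digon d.1 u.1]]].

Lemma leqif_lt (m n : nat) b : (m < n)%N -> ~~ b -> (m <= n ?= iff b)%N.
Proof. by move=> lt /negbTE ->; split; [exact: ltnW|rewrite ltn_eqF]. Qed.

Lemma ltn_neq_vertex (f : V -> nat) v w : (f v < f w)%N -> v != w.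
Proof. by apply: contraTneq => ->; rewrite ltnn. Qed.

Lemma fpair_only F t1 t2 x : fpair F t1 t2 -> x \in F -> tdart x -> col x = col t1 -> x = t1.
Proof.
case=> _ _ c2 only xF tx cx; case: (only _ xF tx) => // xE.
by move/eqP: cx; rewrite xE c2 eq_sym Z4_neqE.
Qed.

Lemma cuts_up t u : cuts t (rev_dart u) -> [/\ off_root u, (yc (source u) < t)%N,
  (t <= yc (target u))%N & (yc (source u) < yc (target u))%N].
Proof.
case/and3P; rewrite off_root_rev {1}/target rev_dartK => un u1 u2; split=> //.
exact: leq_trans u1 u2.
Qed.

Lemma ltn_contra (m n : nat) : (m < n)%N -> (n < m)%N -> False.
Proof. by move=> /ltnW; rewrite leqNgt => /negP. Qed.

Lemma thin_eq (p q t : nat) : p = q.+1 -> (q < t)%N -> (t <= p)%N -> p = t /\ q.+1 = t.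
Proof. by move=> ->; lia. Qed.

(** Color 1 descends and color 3 ascends. The lowest point of the first chain is one unit above the
    highest point of the second, so [d] or [u] is a turn; if both are, they join the chains across
    the gap. *)
Lemma face_cmp_odd F t1 t2 t d u : fpair F t1 t2 -> col t1 = 1 -> col t2 = 3 ->
  (forall x, x \in F -> col x = 1 \/ col x = 3) ->
  d \in F -> u \in F -> cuts t d -> cuts t (rev_dart u) -> compared t d u.
Proof.
move=> fpr c1 c2 cols dF uF cd cu; have rfp := fpair_sym fpr.
case: (fpr) => FN [t1F t2F td1 td2] _ _.
have ylt := cuts_lt cd; case/and3P: (cd) => dn d1 d2; have [un u1 u2 ylt'] := cuts_up cu.
case/andP: (dn) => sdn tdn; case/andP: (un) => sun tun.
have /andP [st1 tt1] := tdart_off_root td1; have /andP [st2 tt2] := tdart_off_root td2.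
have fd : fp d \in F by rewrite mem_fp.
have fu : fp u \in F by rewrite mem_fp.
have cold : col d = 1.
  case: (cols _ dF) => // c; case: (boolP (tdart d)) => td.
    by have [_ /(ltn_contra ylt)] := tdart3_dir td c.
  by have [_ /(ltn_contra ylt)] := sdart3_dir dn td c.
have colu : col u = 3.
  case: (cols _ uF) => // c; case: (boolP (tdart u)) => td.
    by have [_ /(ltn_contra ylt')] := tdart1_dir td c.
  by have [_ /(ltn_contra ylt')] := sdart1_dir un td c.
have ysucc : yc (source t1) = (yc (source t2)).+1.
  have := fpair_source fpr; rewrite c1 (_ : 1 + 3 = 0 :> 'Z_4) //; exact: val_inj.
have e13 : (0 : 'Z_4) = 1 + 3 by exact: val_inj.
have e33 : (2 : 'Z_4) = 3 + 3 by exact: val_inj.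
have xU x : x \in F -> col x = 1 -> (xc (source x) <= xc (target t2) ?= iff (source x == target
  t2))%N.
  by move=> xF cx; apply: (fpair_upper (c := 1) fpr _ xF); rewrite c1 //; left.
have yL x : x \in F -> col x = 1 -> (yc (source t1) <= yc (source x))%N.
  move=> xF cx; have cc : 0 = col t1 \/ 0 = col t1 + 3 by right; rewrite c1; exact: e13.
  by case: (fpair_lower fpr cc xF (etrans cx (esym c1))).
have xL x : x \in F -> col x = 3 -> (xc (target t1) <= xc (source x) ?= iff (target t1 == source
  x))%N.
  move=> xF cx; rewrite eq_sym; apply: (crd_opp_leqif opp3 _ tt1).
    by have /andP [] := nonroot_off_root FN xF.
  by apply: (fpair_upper (c := 3) rfp _ xF); rewrite c2 //; left.
have yU x : x \in F -> col x = 3 -> (yc (source x) <= yc (source t2))%N.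
  move=> xF cx; have xn : source x != vs by have /andP [] := nonroot_off_root FN xF.
  have l : (crd 2 (source t2) <= crd 2 (source x) ?= iff (x == t2))%N.
    by apply: (fpair_lower (c := 2) rfp _ xF); rewrite c2 //; right.
  by case: (crd_opp_leqif opp2 st2 xn l).
have [td|sd] := boolP (tdart d); have [tu|su] := boolP (tdart u).
- have dE : d = t1 by apply: (fpair_only fpr); rewrite ?c1.
  have uE : u = t2 by apply: (fpair_only rfp); rewrite ?c2.
  subst d u; have [ya yb] := thin_eq ysucc u1 d2.
  have [x1 _] := tdart1_dir td1 c1; have [x2 _] := tdart3_dir td2 c2.
  split; [exact: xU|exact: xL|constructor 3; split=> //; exact: (fpair_digon fpr)].
- have dE : d = t1 by apply: (fpair_only fpr); rewrite ?c1.
  subst d; have [x1 _] := tdart1_dir td1 c1; have [x2 _] := sdart3_dir un su colu.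
  have l := xL u uF colu; have lt := leq_ltn_trans (leq_trans (ltnW x1) l) x2.
  have lt' : (xc (source t1) < xc (target u))%N := lt.
  split; [exact: (leqif_lt lt' (ltn_neq_vertex lt'))|exact: l|by constructor 2].
- have uE : u = t2 by apply: (fpair_only rfp); rewrite ?c2.
  subst u; have [x2 _] := tdart3_dir td2 c2; have [x1 _] := sdart1_dir dn sd cold.
  have l := xU d dF cold; have lt := leq_ltn_trans (leq_trans (ltnW x1) l) x2.
  have lt' : (xc (target d) < xc (source t2))%N := lt.
  split; [exact: l|exact: (leqif_lt lt' (ltn_neq_vertex lt'))|by constructor 1].
- have cfd : col (fp d) = 1 by rewrite col_fp_s.
  have cfu : col (fp u) = 3 by rewrite col_fp_s.
  have l1 := yL _ fd cfd; have l3 := yU _ fu cfu.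
  rewrite source_face_perm in l1; rewrite source_face_perm in l3.
  exfalso; move: ysucc l1 l3 d1 u2; clear.
  move: (yc _) (yc _) (yc _) (yc _) => p q m n; lia.
Qed.

(** Here a turn goes vertically against its own chain: [t1] descends like the chain of color 0, and
    [t2] ascends like the chain of color 2, which lies one unit above the other. *)
Lemma face_cmp_even F t1 t2 t d u : fpair F t1 t2 -> col t1 = 2 -> col t2 = 0 ->
  (forall x, x \in F -> col x = 2 \/ col x = 0) ->
  d \in F -> u \in F -> cuts t d -> cuts t (rev_dart u) -> compared t d u.
Proof.
move=> fpr c1 c2 cols dF uF cd cu; have rfp := fpair_sym fpr.
case: (fpr) => FN [t1F t2F td1 td2] _ _.
have ylt := cuts_lt cd; case/and3P: (cd) => dn d1 d2; have [un u1 u2 ylt'] := cuts_up cu.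
case/andP: (dn) => sdn tdn; case/andP: (un) => sun tun.
have /andP [st1 tt1] := tdart_off_root td1; have /andP [st2 tt2] := tdart_off_root td2.
have fd : fp d \in F by rewrite mem_fp.
have fu : fp u \in F by rewrite mem_fp.
have ysucc : yc (target t2) = (yc (target t1)).+1.
  apply: (crd_opp_succ opp2 tt1 tt2); have := fpair_target fpr; by rewrite c1.
have e23 : (1 : 'Z_4) = 2 + 3 by exact: val_inj.
have e03 : (3 : 'Z_4) = 0 + 3 by exact: val_inj.
have xL2 x : x \in F -> col x = 2 -> (xc (source t1) <= xc (source x) ?= iff (x == t1))%N.
  by move=> xF cx; apply: (fpair_lower (c := 1) fpr _ xF); rewrite c1 //; right.
have xU2 x : x \in F -> col x = 2 -> (xc (source x) <= xc (target t2) ?= iff (source x == target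
  t2))%N.
  by move=> xF cx; apply: (fpair_upper (c := 1) fpr _ xF); rewrite c1 //; right.
have yU2 x : x \in F -> col x = 2 -> (yc (target t2) <= yc (source x))%N.
  move=> xF cx; have xn : source x != vs by have /andP [] := nonroot_off_root FN xF.
  have l : (crd 2 (source x) <= crd 2 (target t2) ?= iff (source x == target t2))%N.
    by apply: (fpair_upper (c := 2) fpr _ xF); rewrite c1 //; left.
  by case: (crd_opp_leqif opp2 xn tt2 l).
have xL0 x : x \in F -> col x = 0 -> (xc (source x) <= xc (source t2) ?= iff (x == t2))%N.
  move=> xF cx; apply: (crd_opp_leqif opp3 st2); first by have /andP [] := nonroot_off_root FN xF.
  by apply: (fpair_lower (c := 3) rfp _ xF); rewrite c2 //; right.
have xU0 x : x \in F -> col x = 0 -> (xc (target t1) <= xc (source x) ?= iff (source x == target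
  t1))%N.
  move=> xF cx; apply: (crd_opp_leqif opp3 _ tt1);
    first by have /andP [] := nonroot_off_root FN xF.
  by apply: (fpair_upper (c := 3) rfp _ xF); rewrite c2 //; right.
have yU0 x : x \in F -> col x = 0 -> (yc (source x) <= yc (target t1))%N.
  move=> xF cx; have l : (crd 0 (source x) <= crd 0 (target t1) ?= iff (source x == target t1))%N.
    by apply: (fpair_upper (c := 0) rfp _ xF); rewrite c2 //; left.
  by case: l.
have ds : (tdart d /\ col d = 2) \/ (~~ tdart d /\ col d = 0).
  case: (boolP (tdart d)) => td; [left|right]; split=> //; case: (cols _ dF) => // c; exfalso.
    by have [/(ltn_contra ylt)] := tdart0_dir td c.
  by have [/(ltn_contra ylt)] := sdart2_dir dn td c.
have us : (tdart u /\ col u = 0) \/ (~~ tdart u /\ col u = 2).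
  case: (boolP (tdart u)) => td; [left|right]; split=> //; case: (cols _ uF) => // c; exfalso.
    by have [/(ltn_contra ylt')] := tdart2_dir td c.
  by have [/(ltn_contra ylt')] := sdart0_dir un td c.
case: ds us => -[td cold] [] [tu colu].
- have dE : d = t1 by apply: (fpair_only fpr); rewrite ?c1.
  have uE : u = t2 by apply: (fpair_only rfp); rewrite ?c2.
  subst d u; have [yb ya] := thin_eq ysucc d1 u2.
  have [_ x1] := tdart2_dir td1 c1; have [_ x2] := tdart0_dir td2 c2.
  split; [exact: xU2| |constructor 4; split=> //; exact: (fpair_digon fpr)].
  by rewrite eq_sym; apply: xU0.
- have dE : d = t1 by apply: (fpair_only fpr); rewrite ?c1.
  subst d; have [_ x1] := tdart2_dir td1 c1; have [_ x2] := sdart2_dir un tu colu.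
  have cfu : col (fp u) = 2 by rewrite col_fp_s.
  have l := xL2 _ fu cfu; rewrite source_face_perm in l.
  have eqE : (fp u == t1) = (source t1 == target u).
    apply/eqP/eqP => [<-|e]; first by rewrite source_face_perm.
    by apply: col_inj; rewrite ?source_face_perm // cfu.
  rewrite eqE in l; have lt := leq_ltn_trans (leq_trans (ltnW x1) l) x2.
  have lt' : (xc (target t1) < xc (source u))%N := lt.
  split; [exact: l|exact: (leqif_lt lt' (ltn_neq_vertex lt'))|by constructor 1].
- have uE : u = t2 by apply: (fpair_only rfp); rewrite ?c2.
  subst u; have [_ x2] := tdart0_dir td2 c2; have [_ x1] := sdart0_dir dn td cold.
  have cfd : col (fp d) = 0 by rewrite col_fp_s.
  have l := xL0 _ fd cfd; rewrite source_face_perm in l.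
  have eqE : (fp d == t2) = (target d == source t2).
    apply/eqP/eqP => [<-|e]; first by rewrite source_face_perm.
    by apply: col_inj; rewrite ?source_face_perm // cfd.
  rewrite eqE in l; have lt := leq_ltn_trans (leq_trans (ltnW x1) l) x2.
  have lt' : (xc (source d) < xc (target t2))%N := lt.
  split; [exact: (leqif_lt lt' (ltn_neq_vertex lt'))|exact: l|by constructor 2].
- have l0 := yU0 _ dF cold; have l2 := yU2 _ uF colu.
  exfalso; move: ysucc l0 l2 d2 u1; clear.
  move: (yc _) (yc _) (yc _) (yc _) => p q m n; lia.
Qed.

Lemma face_cmp F t d u : F \in nonroot_faces vs -> d \in F -> u \in F ->
  cuts t d -> cuts t (rev_dart u) -> compared t d u.
Proof.
move=> FN dF uF cd cu; have [t1 [t2 [fpr [] c1 cols]]] := fpair_exists FN;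
  case: (fpr) => _ _ c2 _; rewrite c1 in c2.
  have c2' : col t2 = 3 by rewrite c2; exact: val_inj.
  by apply: (face_cmp_odd fpr c1 c2'); rewrite -?c2' -?c1.
have c2' : col t2 = 0 by rewrite c2; exact: val_inj.
by apply: (face_cmp_even fpr c1 c2'); rewrite -?c2' -?c1.
Qed.

(** * Sweeping by horizontal lines *)

Section Height.
Variables (R : realFieldType) (t : nat).

Definition X d (s : R) : R := interp (xc (source d))%:R (yc (source d))%:R
  (xc (target d))%:R (yc (target d))%:R s.

Lemma natr_ltD1 (m n : nat) : (m < n)%N -> m%:R + 1 <= n%:R :> R.
Proof. by move=> lt; rewrite natr1 ler_nat. Qed.

Lemma compared_X d u (s : R) : cuts t d -> cuts t (rev_dart u) -> compared t d u ->
  t%:R - 1 < s -> s <= t%:R ->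
  X d s <= X (rev_dart u) s /\
  (X d s = X (rev_dart u) s -> source d = target u /\
     (s = t%:R /\ yc (source d) = t \/ bound_digon d.1 u.1)).
Proof.
move=> cd cu [cmp1 cmp2 cases] s0 s1.
have [/and3P [_ d1 d2] [_ u1 u2 _]] := (cd, cuts_up cu).
have {}d1 := natr_ltD1 d1; have {}u1 := natr_ltD1 u1.
have e2 : (t <= yc (source d))%N = (t%:R <= (yc (source d))%:R :> R) by rewrite ler_nat.
have e3 : (t <= yc (target u))%N = (t%:R <= (yc (target u))%:R :> R) by rewrite ler_nat.
rewrite e2 in d2; rewrite e3 in u2.
rewrite /X [target (rev_dart u)]/target rev_dartK -/(target u).
have le1 : (xc (source d))%:R <= (xc (target u))%:R :> R by rewrite ler_nat; case: cmp1.
have le2 : (xc (target d))%:R <= (xc (source u))%:R :> R by rewrite ler_nat; case: cmp2.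
have eq1 : (xc (source d))%:R = (xc (target u))%:R :> R -> source d = target u.
  by move=> /eqP; rewrite eqr_nat cmp1 => /eqP.
have eq2 : (xc (target d))%:R = (xc (source u))%:R :> R -> target d = source u.
  by move=> /eqP; rewrite eqr_nat cmp2 => /eqP.
have ltR (p q : nat) : (p < q)%N -> p%:R < q%:R :> R by rewrite ltr_nat.
have eqR (p q : nat) : p%:R = q%:R :> R -> p = q by move=> /eqP; rewrite eqr_nat => /eqP.
have sR (p q : nat) : p.+1 = q -> p%:R + 1 = q%:R :> R by move=> <-; rewrite natr1.
have eqR' (p q : nat) : p = q -> p%:R = q%:R :> R by move=> ->.
have [|le eq] := interp_compare d1 d2 u1 u2 s0 s1 le1 le2.
  case: cases => [[/ltR a /ltR b]|[/ltR a /ltR b]|[/eqR' a /sR b [/ltR c /ltR e] _ _]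
    |[/sR a /eqR' b [/ltR c /ltR e] _ _]].
  - by constructor 1.
  - by constructor 2.
  - by constructor 3.
  - by constructor 4.
split=> [|/eq [/eq1 e1 e4]]; first exact: le.
split; first exact: e1.
case: e4 => [[-> yt]|/eq2 e4]; first left.
  by split; [|case: yt => /eqR; rewrite ?e1].
right; case: cases => [[a1 a2]|[a1 a2]|[_ _ _ _ dg]|[_ _ _ _ dg]]; try exact: dg.
- by case: (ltn_contra a1); rewrite e4 e1.
- by case: (ltn_contra a1); rewrite e4 e1.
Qed.

End Height.

(* [d'] is crossed immediately to the right of [d] by a horizontal line whose height
   is in [t - 1, t]. *)
Definition step t : rel D := [rel d d' | [&& cuts t d, cuts t d',
  face_of d \in nonroot_faces vs & rev_dart d' \in face_of d]].

(** Otherwise the contour would stay below height [t] after [d], yet it returns to the source of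
    [d]. *)
Lemma step_exists t d : cuts t d -> face_of d \in nonroot_faces vs -> exists d', step t d d'.
Proof.
move=> cd FN; case: (boolP [exists d', step t d d']) => [/existsP//|/existsPn no].
have /and3P [dn d1 d2] := cd.
have below : forall x, x \in face_of (fp d) -> (yc (source x) < t)%N.
  apply: face_closed; last by rewrite source_face_perm.
  move=> x; rewrite face_of_perm => xF yx; rewrite source_face_perm ltnNge; apply/negP => tx.
  have := no (rev_dart x); rewrite /step /= cd FN rev_dartK xF !andbT /= => /negP; apply.
  by rewrite /cuts off_root_rev (nonroot_off_root FN xF) /target rev_dartK yx.
have := below d; rewrite face_of_perm porbit_id => /(_ isT).
by rewrite ltnNge d2.
Qed.

(** [P] is a descending run of a contour, beginning at [z]. Walking back raises the source and
    heights are bounded, so [z] is reached; of two darts of the run, the later starts no higher than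
    the earlier ends. *)
Lemma cuts_unique (P : pred D) z t d1 d2 :
  (forall x, P x -> off_root x && (yc (target x) < yc (source x))%N) ->
  (forall x, P x -> x != z -> P (fp^-1%g x)) ->
  P d1 -> P d2 -> cuts t d1 -> cuts t d2 -> d1 = d2.
Proof.
move=> Pn Pz P1 P2 c1 c2.
have chain x : P x -> exists k : nat, x = iter k fp z /\ forall j : nat, (j <= k)%N -> P (iter j
  fp z).
  have [n] := ubnP (#|V| - 2 - yc (source x))%N; elim: n x => [|n IH] x; first by rewrite ltn0.
  move=> ltn Px.
  have [xz|xz] := eqVneq x z.
    by exists 0%N; split=> // j; rewrite leqn0 => /eqP ->; rewrite /= -xz.
  pose y := fp^-1%g x; have Py : P y by apply: Pz.
  have xE : x = fp y by rewrite permKV.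
  have /andP [/andP [sn _]] := Pn _ Py; rewrite -source_face_perm -xE => lt.
  have bnd : (yc (source y) <= #|V| - 2)%N := crd_bound 0%R sn.
  have ltn' : (#|V| - 2 - yc (source y) < n)%N.
    by move: lt ltn bnd; move: (yc _) (yc _) (#|V| - 2)%N => p q m; clear; lia.
  have [k [kE kP]] := IH _ ltn' Py; exists k.+1; split; first by rewrite iterS -kE.
  by move=> j; rewrite leq_eqVlt => /orP [/eqP ->|/kP //]; rewrite iterS -kE -xE.
wlog: d1 d2 P1 P2 c1 c2 / exists k m : nat, [/\ d1 = iter k fp z, d2 = iter m fp z,
    (k <= m)%N & forall j : nat, (j <= m)%N -> P (iter j fp z)].
  move=> W; have [k [kE kP]] := chain _ P1; have [m [mE mP]] := chain _ P2.
  case: (leqP k m) => km; first by apply: W => //; exists k, m.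
  by apply/esym; apply: W => //; exists m, k; split=> //; apply: ltnW.
case=> k [m [kE mE]]; rewrite leq_eqVlt => /orP [/eqP km _|km mP]; first by rewrite kE mE km.
have low (j : nat) : (k < j)%N -> (j <= m)%N -> (yc (source (iter j fp z)) <= yc (target d1))%N.
  elim: j => [|j IH]; first by rewrite ltn0.
  rewrite ltnS leq_eqVlt => /orP [/eqP <- _|kj jm].
    by rewrite iterS source_face_perm -kE.
  apply: leq_trans (IH kj (ltnW jm)); rewrite iterS source_face_perm.
  by have /andP [_ /ltnW] := Pn _ (mP j (ltnW jm)).
have := low m km (leqnn m); rewrite -mE.
case/and3P: c1 => _ lt1 _; case/and3P: c2 => _ _ le2 le3.
by have := leq_trans le2 le3; rewrite leqNgt lt1.
Qed.

(** The descending run is the chain of color 1, which begins after [t2], or else the turn [t1] of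
    color 2 followed by the non-turning darts of color 0. *)
Lemma cuts_unique_nonroot F t d1 d2 : F \in nonroot_faces vs -> d1 \in F -> d2 \in F ->
  cuts t d1 -> cuts t d2 -> d1 = d2.
Proof.
move=> FN d1F d2F cd1 cd2; have [t1 [t2 [fpr c1 cols]]] := fpair_exists FN.
have rfp := fpair_sym fpr; case: (fpr) => _ [t1F t2F td1 td2] c2 only.
have back x : x \in F -> fp^-1%g x \in F by move=> xF; rewrite -mem_fp // permKV.
case: c1 => c1; rewrite c1 in c2.
- have {}c2 : col t2 = 3 by rewrite c2; exact: val_inj.
  rewrite c1 c2 in cols.
  pose P x := (x \in F) && (col x == 1).
  have PP x : P x -> off_root x && (yc (target x) < yc (source x))%N.
    case/andP=> xF /eqP cx; rewrite (nonroot_off_root FN xF) /=.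
    case: (boolP (tdart x)) => tx; first by case: (tdart1_dir tx cx).
    by case: (sdart1_dir (nonroot_off_root FN xF) tx cx).
  have down x : x \in F -> cuts t x -> P x.
    move=> xF cx; rewrite /P xF; have ylt := cuts_lt cx; have xn := cuts_off_root cx.
    case: (cols _ xF) => [->//|c]; exfalso.
    case: (boolP (tdart x)) => tx; first by have [_ /(ltn_contra ylt)] := tdart3_dir tx c.
    by have [_ /(ltn_contra ylt)] := sdart3_dir xn tx c.
  apply: (@cuts_unique P (fp t2) t) => //; try exact: down.
  move=> x /andP [xF /eqP cx] xz; have yF := back _ xF; rewrite /P yF /=.
  have xE : x = fp (fp^-1%g x) by rewrite permKV.
  case: (boolP (tdart (fp^-1%g x))) => ty; last first.
    by rewrite -cx [in X in _ == X]xE col_fp_s // (nonroot_off_root FN yF).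
  case: (only _ yF ty) => yE; last by rewrite xE yE eqxx in xz.
  by rewrite yE c1.
have {}c2 : col t2 = 0 by rewrite c2; exact: val_inj.
rewrite c1 c2 in cols.
pose P x := (x \in F) && (if tdart x then col x == 2 else col x == 0).
have PP x : P x -> off_root x && (yc (target x) < yc (source x))%N.
  case/andP=> xF; rewrite (nonroot_off_root FN xF) /=.
  case: (boolP (tdart x)) => tx /eqP cx; first by case: (tdart2_dir tx cx).
  by case: (sdart0_dir (nonroot_off_root FN xF) tx cx).
have down x : x \in F -> cuts t x -> P x.
  move=> xF cx; rewrite /P xF /=; have ylt := cuts_lt cx; have xn := cuts_off_root cx.
  case: (boolP (tdart x)) => tx; case: (cols _ xF) => c; rewrite ?c //; exfalso.
    by have [/(ltn_contra ylt)] := tdart0_dir tx c.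
  by have [/(ltn_contra ylt)] := sdart2_dir xn tx c.
apply: (@cuts_unique P t1 t) => //; try exact: down.
move=> x /andP [xF cx] xz; have yF := back _ xF; rewrite /P yF /=.
have xE : x = fp (fp^-1%g x) by rewrite permKV.
have {cx} cx : col x = 0.
  move: cx; case: (boolP (tdart x)) => [tx|_ /eqP //] /eqP cx; case/eqP: xz.
  by apply: (fpair_only fpr) => //; rewrite c1.
case: (boolP (tdart (fp^-1%g x))) => ty; last first.
  by rewrite -cx [in X in _ == X]xE col_fp_s // (nonroot_off_root FN yF).
case: (only _ yF ty) => yE; first by rewrite yE c1.
move: cx; rewrite xE yE col_fp_t // c2 => /eqP.
by rewrite add0r.
Qed.

(** * Root-faces at the right end of the sweep *)

Lemma root_face_back j x : x \in face_of (r j) -> off_root x -> x != fp (r j) -> off_root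
  (fp^-1%g x).
Proof.
move=> xF /andP [sn _] xz; have xE : x = fp (fp^-1%g x) by rewrite permKV.
have yF : fp^-1%g x \in face_of (r j) by rewrite -mem_face_perm -xE.
rewrite /off_root -source_face_perm -xE sn andbT; apply: contra xz => /eqP sy.
by rewrite {1}xE (root_face_source yF sy).
Qed.

Lemma root_face_down j x : x \in face_of (r j) -> off_root x -> col x = 1 \/ col x = 0 ->
  (yc (target x) < yc (source x))%N.
Proof.
move=> xF xn [] c; have sx := root_face_s xF.
  by case: (sdart1_dir xn sx c).
by case: (sdart0_dir xn sx c).
Qed.

Lemma cuts_root t d : cuts t d -> face_of d \notin nonroot_faces vs ->
  d \in face_of (r 0) \/ d \in face_of (r 3).
Proof.
move=> cd; rewrite nonroot_faceP; last exact: imset_f.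
move=> /negPn /imsetP [j _ FE].
have dF : d \in face_of (r j) by rewrite -FE porbit_id.
have dn := cuts_off_root cd; have sd := root_face_s dF; have ylt := cuts_lt cd.
have cE : col d = j + 1 by apply: root_face_col => //; case/andP: dn.
case: (Z4_cases 3 j) => jE.
- by right; rewrite -jE.
- by left; rewrite (_ : 0 = j) // jE; exact: val_inj.
- have c2 : col d = 2 by rewrite cE jE; exact: val_inj.
  by have [/(ltn_contra ylt)] := sdart2_dir dn sd c2.
- have c3 : col d = 3 by rewrite cE jE; exact: val_inj.
  by have [_ /(ltn_contra ylt)] := sdart3_dir dn sd c3.
Qed.

Lemma root_face_cuts_unique j t d d' : j + 1 = 1 \/ j + 1 = 0 ->
  d \in face_of (r j) -> d' \in face_of (r j) -> cuts t d -> cuts t d' -> d = d'.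
Proof.
move=> jc dF d'F cd cd'.
apply: (@cuts_unique (fun x => (x \in face_of (r j)) && off_root x) (fp (r j)) t) => //.
- move=> x /andP [xF xn]; rewrite xn /=; apply: (root_face_down xF xn).
  by rewrite (root_face_col xF) //; case/andP: xn.
- move=> x /andP [xF xn] xz; rewrite (root_face_back xF xn xz) andbT.
  by rewrite -mem_face_perm permKV.
- by rewrite dF (cuts_off_root cd).
- by rewrite d'F (cuts_off_root cd').
Qed.

(** The contour of this root-face descends from [target (r 0)], while that of [r 3] descends to it:
    together they form one descending path. *)
Lemma root_face0_high d : d \in face_of (r 0) -> off_root d ->
  (yc (source d) <= yc (target (r 0%R)))%N.
Proof.
have [n] := ubnP (#|V| - 2 - yc (source d))%N; elim: n d => [|n IH] d; first by rewrite ltn0.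
move=> ltn dF dn; have [->|dz] := eqVneq d (fp (r 0)); first by rewrite source_face_perm.
have yn := root_face_back dF dn dz; set y := fp^-1%g d in yn.
have dE : d = fp y by rewrite permKV.
have yF : y \in face_of (r 0) by rewrite -mem_face_perm -dE.
have /andP [sn _] := yn.
have cy : col y = 1 by rewrite (root_face_col yF sn) add0r.
have lt := root_face_down yF yn (or_introl cy).
rewrite -source_face_perm -dE in lt.
have bnd : (yc (source y) <= #|V| - 2)%N := crd_bound 0%R sn.
have ltn' : (#|V| - 2 - yc (source y) < n)%N.
  by move: lt ltn bnd; move: (yc _) (yc _) (#|V| - 2)%N => p q m; clear; lia.
exact: leq_trans (ltnW lt) (IH _ ltn' yF yn).
Qed.

Lemma root_face3_low d : d \in face_of (r 3) -> off_root d ->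
  (yc (target (r 0%R)) <= yc (target d))%N.
Proof.
have e31 : 3 + 1 = 0 :> 'Z_4 by exact: val_inj.
have [n] := ubnP (yc (source d)); elim: n d => [|n IH] d; first by rewrite ltn0.
move=> ltn dF dn; have fF : fp d \in face_of (r 3) by rewrite mem_face_perm.
have /andP [sn tn] := dn.
have cd : col d = 0 by rewrite (root_face_col dF sn).
have lt := root_face_down dF dn (or_intror cd).
have [tv|tv] := eqVneq (target (fp d)) vs.
  have [j jE] := root_dart tv.
  have cf : col (fp d) = 0 by rewrite (root_face_col fF) ?source_face_perm.
  have jz : j = 0 by rewrite -cf -[fp d]rev_dartK jE col_rev_r.
  by rewrite -(source_face_perm d) -[fp d]rev_dartK jE jz.
have fn : off_root (fp d) by rewrite /off_root source_face_perm tn.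
have ltn' : (yc (source (fp d)) < n)%N by rewrite source_face_perm; apply: leq_trans lt ltn.
have cf : col (fp d) = 0 by rewrite (root_face_col fF) ?source_face_perm.
have := root_face_down fF fn (or_intror cf); rewrite source_face_perm => /ltnW.
exact: leq_trans (IH _ ltn' fF fn).
Qed.

Lemma end_unique t d d' : cuts t d -> cuts t d' -> face_of d \notin nonroot_faces vs ->
  face_of d' \notin nonroot_faces vs -> d = d'.
Proof.
move=> cd cd' FN FN'.
have e31 : 3 + 1 = 0 :> 'Z_4 by exact: val_inj.
have mixed x y : cuts t x -> cuts t y -> x \in face_of (r 0) -> y \in face_of (r 3) -> x = y.
  move=> cx cy xF yF; have h := root_face0_high xF (cuts_off_root cx).
  have l := root_face3_low yF (cuts_off_root cy).
  case/and3P: cx => _ _ a; case/and3P: cy => _ b _.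
  by have := leq_trans a (leq_trans h l); rewrite leqNgt b.
case: (cuts_root cd FN) => dF; case: (cuts_root cd' FN') => dF'.
- by apply: (root_face_cuts_unique (j := 0)) dF dF' cd cd'; left; rewrite add0r.
- exact: mixed.
- by apply/esym; apply: mixed.
- by apply: (root_face_cuts_unique (j := 3)) dF dF' cd cd'; right.
Qed.

Lemma step_inj t d1 d2 d : step t d1 d -> step t d2 d -> d1 = d2.
Proof.
case/and4P=> c1 _ F1 m1 /and4P [c2 _ F2 m2].
apply: (cuts_unique_nonroot (t := t) F1) => //; first exact: porbit_id.
by rewrite (nonroot_face F1 m1) -(nonroot_face F2 m2) porbit_id.
Qed.

Lemma step_compared t d d' : step t d d' -> compared t d (rev_dart d').
Proof.
case/and4P=> c1 c2 FN m; apply: face_cmp FN _ m c1 _; first exact: porbit_id.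
by rewrite rev_dartK.
Qed.

(** Abscissas may stay the same along [step], in particular across a digon; then the first dart is a
    turn and the second is not, and the last bit breaks the tie. *)
Definition sweep_rank d : nat := ((xc (source d) + xc (target d)).*2 + ~~ tdart d)%N.

Lemma target_rev d : target (rev_dart d) = source d.
Proof. by rewrite /target rev_dartK. Qed.

Lemma rank_lt (a b c e : nat) (f g : bool) : (a <= c)%N -> (b <= e)%N ->
  (a = c -> b = e -> f = false /\ g = true) ->
  ((a + b).*2 + f < (c + e).*2 + g)%N.
Proof.
move=> h1 h2 h3; have [e1|n1] := eqVneq a c; last by case: f g {h3} => [] []; lia.
have [e2|n2] := eqVneq b e; last by case: f g {h3} => [] []; lia.
by case: (h3 e1 e2) => -> ->; lia.
Qed.

Lemma tdart_flags d d' : tdart d /\ tdart (rev_dart d') ->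
  ~~ tdart d = false /\ ~~ tdart d' = true.
Proof.
by case=> -> td; split; [|rewrite -tdart_rev; [|rewrite -off_root_rev; apply: tdart_off_root]].
Qed.

Lemma step_rank t d d' : step t d d' -> (sweep_rank d < sweep_rank d')%N.
Proof.
move=> /step_compared; rewrite /compared target_rev -/(target d').
case=> [[l1 _] [l2 _] cases]; apply: rank_lt l1 l2 _ => e1 e2; apply: tdart_flags.
case: cases => [[a1 a2]|[a1 a2]|[_ _ _ tt _]|[_ _ _ tt _]].
- by case: (ltn_contra a1); rewrite e2 e1.
- by case: (ltn_contra a1); rewrite e2 e1.
- exact: tt.
- exact: tt.
Qed.

Lemma sweep_rank_bound d : off_root d -> (sweep_rank d <= 4 * #|V| + 1)%N.
Proof.
case/andP=> sn tn; have h1 : (xc (source d) <= #|V| - 2)%N := crd_bound 1%R sn.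
have h2 : (xc (target d) <= #|V| - 2)%N := crd_bound 1%R tn.
rewrite /sweep_rank; case: (tdart d) => /=;
  by move: h1 h2; move: (xc _) (xc _) (#|V|) => p q m; clear; lia.
Qed.

Lemma step_end t d : cuts t d ->
  exists2 e, connect (step t) d e & cuts t e && (face_of e \notin nonroot_faces vs).
Proof.
have [n] := ubnP (4 * #|V| + 1 - sweep_rank d)%N; elim: n d => [|n IH] d; first by rewrite ltn0.
move=> ltn cd; case: (boolP (face_of d \in nonroot_faces vs)) => FN; last first.
  by exists d; rewrite ?cd ?FN // connect0.
have [d' st] := step_exists cd FN; have lt := step_rank st.
have cd' : cuts t d' by case/and4P: st.
have bnd := sweep_rank_bound (cuts_off_root cd').
have ltn' : (4 * #|V| + 1 - sweep_rank d' < n)%N.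
  by move: lt ltn bnd; move: (sweep_rank _) (sweep_rank _) (#|V|) => p q m; clear; lia.
have [e ce eP] := IH _ ltn' cd'; exists e => //.
exact: connect_trans (connect1 st) ce.
Qed.

(** Predecessors are unique, so two paths into [z] coincide backwards as far as the shorter one
    goes. *)
Lemma connect_merge (T : finType) (e : rel T) x y z :
  (forall a b c, e a c -> e b c -> a = b) ->
  connect e x z -> connect e y z -> connect e x y \/ connect e y x.
Proof.
move=> inj /connectP [p]; elim/last_ind: p z => [|p u IH] z /=.
  by move=> _ -> ?; right.
rewrite rcons_path last_rcons => /andP [pp eu] -> /connectP [q].
case/lastP: q => [_ /= uy|q w].
  by left; apply/connectP; exists (rcons p u); rewrite ?rcons_path ?pp ?last_rcons.
rewrite rcons_path last_rcons => /andP [pq ew] uw; rewrite -uw in ew.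
apply: (IH (last x p)) => //.
by apply/connectP; exists q => //; apply: inj eu ew.
Qed.

Lemma cuts_total t d d' : cuts t d -> cuts t d' ->
  connect (step t) d d' \/ connect (step t) d' d.
Proof.
move=> cd cd'; have [e ce /andP [c1 n1]] := step_end cd.
have [e' ce' /andP [c2 n2]] := step_end cd'.
have ee := end_unique c2 c1 n2 n1; rewrite ee in ce'.
by apply: connect_merge ce ce' => a b c; apply: step_inj.
Qed.

Lemma bound_digon_sym : symmetric (@bound_digon G).
Proof.
suff sym (e f : E) : @bound_digon G e f -> @bound_digon G f e.
  by move=> e f; apply/idP/idP; apply: sym.
case/existsP=> d /exists_inP [d' d'F /and3P [c1 c2 c3]].
apply/existsP; exists d'; apply/exists_inP; exists d.
  by rewrite /face_of porbit_sym.
have -> : face_of d' = face_of d by apply/eqP; rewrite -mem_face_eq.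
by rewrite c1 c2 c3.
Qed.

Lemma connect_X (R : realFieldType) t d d' (s : R) : connect (step t) d d' ->
  t%:R - 1 < s -> s <= t%:R -> X d s <= X d' s /\
  (X d s = X d' s -> source d = source d' /\
     (s = t%:R /\ yc (source d) = t \/ connect (@bound_digon G) d.1 d'.1)).
Proof.
move=> /connectP [p] + + s0 s1; elim: p d => [|e p IH] d /=.
  by move=> _ ->; split=> // _; split=> //; right; apply: connect0.
case/andP=> st pp lp; have [le1 eq1] := IH _ pp lp.
have [cd ce _ _] := and4P st; rewrite -[e in cuts t e]rev_dartK in ce.
have [le2 eq2] := compared_X cd ce (step_compared st) s0 s1.
rewrite rev_dartK in le2 eq2; rewrite target_rev in eq2.
split=> [|E]; first exact: le_trans le2 le1.
have E1 : X d s = X e s.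
  by apply: le_anti; apply/andP; split; [exact: le2|rewrite E; exact: le1].
have E2 : X e s = X d' s by rewrite -E1.
have [sde de] := eq2 E1; have [sed' ed'] := eq1 E2.
split; first by rewrite sde.
case: de => [|de]; first by left.
case: ed' => [|ed']; first by rewrite -sde; left.
by right; apply: connect_trans (connect1 de) ed'.
Qed.

(** * The drawing *)

Lemma off_root_height d : off_root d -> (yc (target d) < yc (source d))%N \/ (yc (source d) < yc
  (target d))%N.
Proof.
move=> dn; have [cd|[cd|[cd|cd]]] : col d = 0 \/ col d = 1 \/ col d = 2 \/ col d = 3.
  by case: (Z4_cases 0 (col d)) => e; rewrite ?add0r in e; tauto.
- case: (boolP (tdart d)) => td; first by case: (tdart0_dir td cd); right.
  by case: (sdart0_dir dn td cd); left.
- case: (boolP (tdart d)) => td; first by case: (tdart1_dir td cd); left.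
  by case: (sdart1_dir dn td cd); left.
- case: (boolP (tdart d)) => td; first by case: (tdart2_dir td cd); left.
  by case: (sdart2_dir dn td cd); right.
- case: (boolP (tdart d)) => td; first by case: (tdart3_dir td cd); right.
  by case: (sdart3_dir dn td cd); right.
Qed.

(** The arc of color 1 descends unless it ends at the root. *)
Lemma bottom_vertex w : w != vs -> yc w = 0%N -> w = target (r 1).
Proof.
move=> wn yw; have [pv|pn] := eqVneq (par 1 w) vs; first exact: par_root_vertex.
have dn : off_root (out 1 w) by rewrite /off_root source_out // wn -parE.
have c1 : col (out 1 w) = 1 by rewrite col_out.
have : (yc (target (out 1%R w)) < yc (source (out 1%R w)))%N.
  by case: (boolP (tdart (out 1 w))) => td; [case: (tdart1_dir td c1)|case: (sdart1_dir dn td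
    c1)].
by rewrite source_out // yw ltn0.
Qed.

Lemma yc_bottom : yc (target (r 1%R)) = 0%N.
Proof. by have := crd_root_vertex 0; rewrite add0r. Qed.

Lemma down_dart w : w != vs -> (0 < yc w)%N -> exists2 d, source d = w & cuts (yc w) d.
Proof.
move=> wn yw; exists (out 1 w); first exact: source_out.
have pn : par 1 w != vs.
  by apply: contraTneq yw => /(par_root_vertex wn) ->; rewrite yc_bottom ltnn.
have dn : off_root (out 1 w) by rewrite /off_root source_out // wn -parE.
have c1 : col (out 1 w) = 1 by rewrite col_out.
have : (yc (target (out 1%R w)) < yc (source (out 1%R w)))%N.
  by case: (boolP (tdart (out 1 w))) => td; [case: (tdart1_dir td c1)|case: (sdart1_dir dn td
    c1)].
by rewrite /cuts dn source_out // => ->; rewrite leqnn.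
Qed.

Section Positions.
Variable R : realFieldType.

Definition pos v : R * R := ((xc v)%:R, (yc v)%:R).

Lemma natR_inj (m n : nat) : m%:R = n%:R :> R -> m = n.
Proof. by move/eqP; rewrite eqr_nat => /eqP. Qed.

Lemma X_top d : (yc (target d) < yc (source d))%N -> X d (yc (source d))%:R = (xc (source d))%:R
  :> R.
Proof. by move=> lt; apply: interp_top; rewrite ltr_nat. Qed.

Lemma X_bottom d : X d (yc (target d))%:R = (xc (target d))%:R :> R.
Proof. exact: interp_bottom. Qed.

Lemma cuts_meet t d d' (s : R) : cuts t d -> cuts t d' -> t%:R - 1 < s -> s <= t%:R ->
  X d s = X d' s -> source d = source d' /\
    (s = t%:R /\ yc (source d) = t \/ connect (@bound_digon G) d.1 d'.1).
Proof.
move=> cd cd' s0 s1 e; case: (cuts_total cd cd') => c; have [_ h] := connect_X c s0 s1.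
  exact: h.
have [e1 e2] := h (esym e); split; first by rewrite e1.
case: e2 => [[a b]|e2]; [left|right]; first by rewrite -e1.
by rewrite (sym_connect_sym bound_digon_sym).
Qed.

(** [t] is the ceiling of [s]; strips are open below, which makes the lower end of the dart a
    separate case. *)
Lemma level d (s : R) : off_root d -> (yc (target d))%:R <= s -> s <= (yc (source d))%:R ->
  s = (yc (target d))%:R \/ exists t : nat, [/\ cuts t d, t%:R - 1 < s & s <= t%:R].
Proof.
move=> dn s0 s1; have [->|ns] := eqVneq s (yc (target d))%:R; [by left|right].
have lt : (yc (target d))%:R < s by rewrite lt_neqAle eq_sym ns.
have ex : exists t : nat, s <= t%:R by exists (yc (source d)).
pose t := ex_minn ex; exists t; rewrite /t; case: ex_minnP => m sm mmin.
have m0 : (yc (target d) < m)%N by rewrite -(ltr_nat R); apply: lt_le_trans lt sm.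
split=> //; first by rewrite /cuts dn m0 mmin.
rewrite ltNge; apply/negP => le.
have m1 : (0 < m)%N by apply: leq_ltn_trans m0.
have := mmin m.-1; rewrite -subn1 natrB // => /(_ le).
by rewrite subn1 -ltnS prednK // ltnn.
Qed.

(** Above height 0, the descending arcs of color 1 from [v] and [w] would meet at their tops, which
    forces a common source. *)
Lemma pos_inj v w : v != vs -> w != vs -> pos v = pos w -> v = w.
Proof.
move=> vn wn [/natR_inj xE /natR_inj yE].
case: (posnP (yc v)) => [y0|yv].
  by rewrite (bottom_vertex vn y0) (bottom_vertex wn) // -yE.
have yw : (0 < yc w)%N by rewrite -yE.
have [d sd cd] := down_dart vn yv; have [d' sd' cd'] := down_dart wn yw.
rewrite -sd -sd'; rewrite -yE in cd'.
have t0 : (yc v)%:R - 1 < (yc v)%:R :> R by rewrite ltrBlDr ltrDl ltr01.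
have h1 := X_top (cuts_lt cd); have h2 := X_top (cuts_lt cd').
rewrite sd in h1; rewrite sd' -yE in h2; rewrite -xE -h1 in h2.
by case: (cuts_meet cd cd' t0 (lexx _) (esym h2)).
Qed.

Lemma vertex_on_dart d w : off_root d -> w != vs -> (yc (target d))%:R <= (yc w)%:R :> R ->
  (yc w)%:R <= (yc (source d))%:R :> R -> (xc w)%:R = X d (yc w)%:R :> R ->
  w = source d \/ w = target d.
Proof.
move=> dn wn s0 s1 xw; case/andP: (dn) => sn tn.
case: (level dn s0 s1) => [yE|[t [cd t0 t1]]].
  right; apply: pos_inj; [exact: wn|exact: tn|]; rewrite /pos; congr pair; last exact: yE.
  by rewrite xw yE X_bottom.
left; have yt : yc w = t.
  apply/eqP; rewrite eqn_leq; move: t1; rewrite ler_nat => -> /=.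
  by rewrite -ltnS -(ltr_nat R) -natr1 -ltrBlDr.
case/and3P: (cd) => _ lo hi; have yw : (0 < yc w)%N by rewrite yt; apply: leq_ltn_trans lo.
have [d' sd' cd'] := down_dart wn yw; rewrite yt in cd'.
have h2 := X_top (cuts_lt cd'); rewrite sd' xw in h2.
by case: (cuts_meet cd cd' t0 t1 (esym h2)) => ->.
Qed.

Lemma off_root_edge (e : E) : e \notin edges_at vs -> off_root (e, true).
Proof. by rewrite -[e]/((e, true).1) edges_atE negb_or. Qed.

Lemma segment_dart (e : E) (q : R * R) : e \notin edges_at vs ->
  on_segment (pos (source (e, true))) (pos (source (e, false))) q ->
  exists d, [/\ d.1 = e, off_root d, (yc (target d))%:R <= q.2, q.2 <= (yc (source d))%:R
    & q.1 = X d q.2].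
Proof.
move=> /off_root_edge en seg; case: (off_root_height en) => lt.
  exists (e, true); have lt' : (pos (target (e, true))).2 < (pos (source (e, true))).2.
    by rewrite /= ltr_nat.
  by have [a b c] := on_segment_interp lt' seg; split.
exists (e, false); have lt' : (pos (source (e, true))).2 < (pos (source (e, false))).2.
  by rewrite /= ltr_nat.
have [a b c] := on_segment_interp lt' (on_segment_sym seg).
by split=> //; rewrite -[(e, false)]/(rev_dart (e, true)) off_root_rev.
Qed.

Lemma endpointE d w : endpoint w d.1 = (w == source d) || (w == target d).
Proof. by case: d => e []; rewrite /endpoint /target /rev_dart //= orbC. Qed.

Lemma vertex_on_segment (e : E) w : e \notin edges_at vs -> w != vs ->
  on_segment (pos (source (e, true))) (pos (source (e, false))) (pos w) -> endpoint w e.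
Proof.
move=> en wn /(segment_dart en) [d [<- dn s0 s1 xE]]; rewrite endpointE.
by case: (vertex_on_dart dn wn s0 s1 xE) => ->; rewrite eqxx ?orbT.
Qed.

Lemma edges_cross (e f : E) (q : R * R) : e \in merged_edges G -> f \in merged_edges G ->
  e \notin edges_at vs -> f \notin edges_at vs -> e != f ->
  on_segment (pos (source (e, true))) (pos (source (e, false))) q ->
  on_segment (pos (source (f, true))) (pos (source (f, false))) q ->
  exists w, [/\ endpoint w e, endpoint w f & q = pos w].
Proof.
move=> eM fM en fn ef se sf.
have [d [de dn s0 s1 xd]] := segment_dart en se.
have [d' [d'f d'n s0' s1' xd']] := segment_dart fn sf.
have q2 : q = (q.1, q.2) by case: (q).
case: (level dn s0 s1) => [yE|[t [cd t0 t1]]].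
  have qw : q = pos (target d) by rewrite q2 xd yE X_bottom.
  exists (target d); split; [by rewrite -de endpointE eqxx orbT| |exact: qw].
  by apply: (vertex_on_segment fn); [case/andP: dn|rewrite -qw].
case: (level d'n s0' s1') => [yE|[t' [cd' t0' t1']]].
  have qw : q = pos (target d') by rewrite q2 xd' yE X_bottom.
  exists (target d'); split; [|by rewrite -d'f endpointE eqxx orbT|exact: qw].
  by apply: (vertex_on_segment en); [case/andP: d'n|rewrite -qw].
(* Both [t] and [t'] are the ceiling of the ordinate of [q], so both edges cross the same strip. *)
have close (m n : nat) (s : R) : m%:R - 1 < s -> s <= n%:R -> (m <= n)%N.
  by move=> a b; rewrite -ltnS -(ltr_nat R) -natr1 -ltrBlDr; apply: lt_le_trans a b.
have tt : t' = t by apply/eqP; rewrite eqn_leq (close _ _ _ t0' t1) (close _ _ _ t0 t1').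
rewrite tt in cd'.
have [sd [[st yt]|dg]] := cuts_meet cd cd' t0 t1 (etrans (esym xd) xd').
  exists (source d); split; [by rewrite -de endpointE eqxx|by rewrite -d'f endpointE sd eqxx|].
  by rewrite q2 xd st -yt (X_top (cuts_lt cd)).
(* Each class of parallel edges keeps a single representative, so [e] and [f] would be equal. *)
have /(fingraph.rootP (sym_connect_sym bound_digon_sym)) := dg.
move: eM fM; rewrite !inE /roots -de -d'f => /eqP -> /eqP -> ee.
by rewrite -de -d'f ee eqxx in ef.
Qed.

End Positions.

End Decomposition.

Theorem theorem6p3 (R : realFieldType) (G : plane_graph) (n : nat)
    (vs : vertex G) (r : 'Z_4 -> dart (edge G))
    (A : 'Z_4 -> {set dart (edge G)}) :
  regular_of_degree G 4 -> mincut G 4 -> #|vertex G| = n ->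
  root_edges vs r ->
  regular_decomposition vs r A -> even_decomposition vs A ->
  let x := xcoord vs r A in
  let y := ycoord vs r A in
  let v_ (i : 'Z_4) := target (r i) in
  [/\ (forall v : vertex G, v != vs -> x v <= n - 2 /\ y v <= n - 2),
      planar_straight_line_drawing [set~ vs]
        (merged_edges G :\: edges_at vs)
        (fun v : vertex G => ((x v)%:R, (y v)%:R)%R : R * R)
    & [/\ y (v_ 1%R) = 0, x (v_ 2%:R%R) = 0,
          y (v_ 3%:R%R) = n - 2 & x (v_ 4%:R%R) = n - 2]].
Proof.
move=> reg4 _ <- rootE dec even x y v_.
have Z4 : (4%:R = 0 :> 'Z_4)%R by exact: val_inj.
have xE v : x v = xc vs r A v by rewrite /xc /crd -lock.
have yE v : y v = yc vs r A v by rewrite /y /ycoord Z4 /yc /crd -lock.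
have pE v : ((x v)%:R, (y v)%:R)%R = pos vs r A R v by rewrite xE yE.
clearbody x y; split.
- by move=> v vn; rewrite xE yE; split; apply: crd_bound.
- split.
  + by move=> v w; rewrite !in_setC1 => vn wn; rewrite (pE v) (pE w); apply: pos_inj.
  + move=> e w; rewrite in_setD in_setC1 => /andP [en _] wn.
    rewrite (pE (source (e, true))) (pE (source (e, false))) (pE w).
    exact: vertex_on_segment.
  + move=> e f q; rewrite !in_setD => /andP [en eM] /andP [fn fM] ef.
    rewrite (pE (source (e, true))) (pE (source (e, false))).
    rewrite (pE (source (f, true))) (pE (source (f, false))) => se sf.
    have [w [we wf ->]] := edges_cross reg4 rootE dec even eM fM en fn ef se sf.
    by exists w; rewrite (pE w).
have vn i : v_ i != vs by apply: target_r.
have crd0 i : crd vs r A i (v_ (i + 1)%R) = 0 by apply: crd_root_vertex.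
have compl i v : v != vs -> crd vs r A i v + crd vs r A (i + 2)%R v = #|vertex G| - 2.
  exact: crd_compl.
split.
- by rewrite yE; have := crd0 0%R; rewrite add0r.
- by rewrite xE; have := crd0 1%R.
(* The complementary coordinate is 0 at this vertex, so this one is [n - 2]. *)
- rewrite yE; have := compl 0%R _ (vn 3%:R%R); have := crd0 2%:R%R.
  rewrite add0r (_ : 2%:R + 1 = 3%:R :> 'Z_4)%R; last exact: val_inj.
  by move=> ->; rewrite addn0.
rewrite xE; have := compl 1%R _ (vn 4%:R%R); have := crd0 3%:R%R.
rewrite (_ : 3%:R + 1 = 4%:R :> 'Z_4)%R; last exact: val_inj.
rewrite (_ : 1 + 2 = 3%:R :> 'Z_4)%R; last exact: val_inj.
by move=> ->; rewrite addn0.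
Qed.
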